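(* Let $H$ be a hexagonal system that has a perfect matching, and let $Af(H)=\max_M af(H,M)$, the maximum taken over all perfect matchings $M$ of $H$. Then for every perfect matching $M$ of $H$ with $af(H,M)=Af(H)$ or $af(H,M)=Af(H)-1$, we have $$af(H,M)=fr(H,M).$$
   Context: A hexagonal system is a 2-connected finite plane graph in which every interior face is bounded by a regular hexagon of side length one (equivalently, a cycle of the infinite hexagonal lattice together with its interior); its interior faces are called hexagons. A perfect matching $M$ of a graph $G$ is a set of edges covering every vertex exactly once. A cycle of $G$ is $M$-alternating if its edges lie alternately in $M$ and in $E(G)\setminus M$. A set $S\subseteq E(G)\setminus M$ is an anti-forcing set of $M$ if $G-S$ has $M$ as its unique perfect matching; the anti-forcing number $af(G,M)$ is the minimum size of an anti-forcing set of $M$. For a hexagonal system $H$ with perfect matching $M$, $fr(H,M)$ denotes the number of hexagons of $H$ that are $M$-alternating. *)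

(* Defs.v *)
From HB Require Import structures.
From mathcomp Require Import all_boot all_order all_algebra.
From mathcomp Require Import finmap.
Set Implicit Arguments. Unset Strict Implicit. Unset Printing Implicit Defensive.
Import Order.TTheory GRing.Theory Num.Theory.
Local Open Scope ring_scope.


(* The infinite hexagonal lattice, drawn as a "brick wall" on Z x Z:
   vertices are integer points (x,y); there is a horizontal edge
   (x,y)--(x+1,y) for all x,y and a vertical edge (x,y)--(x,y+1) iff x+y
   is even.  Its faces are the hexagons with lower-left corner (x,y),
   x+y even, with vertices (x,y),(x+1,y),(x+2,y),(x+2,y+1),(x+1,y+1),(x,y+1). *)
Definition pt := (int * int)%type.

(* An edge is encoded by its lower/left endpoint and a flag:
   (p,false) = horizontal edge p--p+(1,0); (p,true) = vertical edge p--p+(0,1). *)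
Definition edge := (pt * bool)%type.

Definition even_pt (p : pt) : bool := (2 %| p.1 + p.2)%Z.

Definition snd_end (e : edge) : pt :=
  if e.2 then (e.1.1, e.1.2 + 1) else (e.1.1 + 1, e.1.2).

Definition incident (v : pt) (e : edge) : bool := (v == e.1) || (v == snd_end e).

Definition adj : rel pt := fun u v =>
  [|| v == (u.1 + 1, u.2), u == (v.1 + 1, v.2),
      even_pt u && (v == (u.1, u.2 + 1)) | even_pt v && (u == (v.1, v.2 + 1))].

Definition edge_of (u v : pt) : edge :=
  if u.2 == v.2 then (if u.1 < v.1 then (u, false) else (v, false))
  else (if u.2 < v.2 then (u, true) else (v, true)).

Definition lattice_cycle (c : seq pt) : bool :=
  [&& (3 <= size c)%N, uniq c & cycle adj c].

Definition cycle_edges (c : seq pt) : seq edge :=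
  [seq edge_of p.1 p.2 | p <- zip c (rot 1 c)].

(* the six edges of the hexagon with lower-left corner h, in cyclic order *)
Definition hex_edges (h : pt) : seq edge :=
  let x := h.1 in let y := h.2 in
  [:: ((x, y), false); ((x + 1, y), false); ((x + 2, y), true);
      ((x + 1, y + 1), false); ((x, y + 1), false); ((x, y), true)].

(* h is a hexagon lying in the interior of the cycle c: the horizontal ray
   from the centre (x+1, y+1/2) of h going to the left crosses c an odd
   number of times (it crosses exactly the vertical edges (x',y)--(x',y+1)
   with x' <= x). *)
Definition interior_hex (c : seq pt) (h : pt) : bool :=
  even_pt h &&
  odd (count (fun e : edge => [&& e.2, e.1.2 == h.2 & e.1.1 <= h.1])
             (cycle_edges c)).

(* The hexagonal system H bounded by c: its edges and vertices are those of
   its hexagons (the cycle c together with its interior). *)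
Definition inH (c : seq pt) (e : edge) : Prop :=
  exists h, interior_hex c h /\ e \in hex_edges h.
Definition vH (c : seq pt) (v : pt) : Prop :=
  exists e, inH c e /\ incident v e.

Definition is_pm (E : edge -> Prop) (V : pt -> Prop) (M : {fset edge}) : Prop :=
  (forall e, e \in M -> E e) /\
  (forall v, V v -> exists! e, e \in M /\ incident v e).

Definition perfect_matching (c : seq pt) (M : {fset edge}) : Prop :=
  is_pm (inH c) (vH c) M.

Definition anti_forcing (c : seq pt) (M S : {fset edge}) : Prop :=
  (forall e, e \in S -> inH c e /\ e \notin M) /\
  (forall M', is_pm (fun e => inH c e /\ e \notin S) (vH c) M' -> M' = M).

Definition af_is (c : seq pt) (M : {fset edge}) (k : nat) : Prop :=
  (exists S, anti_forcing c M S /\ (#|` S| = k)%fset) /\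
  (forall S, anti_forcing c M S -> (k <= #|` S|%fset)%N).

Definition Af_is (c : seq pt) (A : nat) : Prop :=
  (exists M, perfect_matching c M /\ af_is c M A) /\
  (forall M k, perfect_matching c M -> af_is c M k -> (k <= A)%N).

Definition alternating (M : {fset edge}) (h : pt) : bool :=
  let s := [seq e \in M | e <- hex_edges h] in
  (s == [:: true; false; true; false; true; false]) ||
  (s == [:: false; true; false; true; false; true]).

Definition number_of (T : eqType) (P : T -> Prop) (n : nat) : Prop :=
  exists s : seq T, [/\ uniq s, (forall x, x \in s <-> P x) & size s = n].

Definition fr_is (c : seq pt) (M : {fset edge}) (n : nat) : Prop :=
  number_of (fun h => interior_hex c h /\ alternating M h) n.

(* Main.v *)
Require Import Defs.
From HB Require Import structures.
From mathcomp Require Import all_boot all_order all_algebra.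
From mathcomp Require Import finmap.
From mathcomp Require Import zify.
From Stdlib Require Import Classical.
Set Implicit Arguments. Unset Strict Implicit. Unset Printing Implicit Defensive.
Import Order.TTheory GRing.Theory Num.Theory.
Local Open Scope fset_scope.
Local Open Scope nat_scope.

(* Orient every unmatched edge across from one hexagon to the next, say with
   its white end on the left.  The other perfect matchings differ from M by
   level sets of potentials on the hexagons, so anti-forcing sets are the sets
   of arcs meeting all directed cuts of this dual digraph, and by the
   Lucchesi-Younger theorem af(H,M) is the largest number of arc-disjoint
   directed cuts; the M-alternating hexagons are the one-hexagon cuts.

   Take a packing of af(H,M) cuts of least total size and suppose that some
   cut is not a single hexagon; let X be a smallest such cut.  Every source of
   the digraph inside X then belongs to the packing.  Hexagons carry a height
   that increases by 1 along unmatched and drops by 2 along matched edges.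
   Rotating M on the set Z of lowest hexagons of X turns Z into sinks and all
   successors of Z into sources, and destroys only X and those one-hexagon
   sinks of the packing whose three matched neighbours lie in Z.  On the
   triangular lattice there are at least three more successors than such sinks,
   so the new matching has af(H,M) + 2 disjoint cuts, contradicting
   af(H,M) >= Af(H) - 1. *)

(** * Directed cuts and the Lucchesi-Younger theorem *)

(** Least total weight serves twice: it makes the packing nested, and it forbids replacing [X] by a
    single source. Because the sources of [X] are all packed, the arcs out of the lowest set [Z]
    have no capacity left, so no other cut separates [Z] from its successors; this is what lets the
    remaining cuts survive the rotation. The sources of [Z] are traded for as many sinks, so the
    gain is three (successors over lost sinks) minus one (the cut [X]), and a gain of two is exactly
    what [A - 1] rules out. Planarity enters through potentials: the potential of the difference of
    two matchings has to vanish outside the system, and since the interior is defined by a crossing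
    parity, this requires proving that the exterior is connected. Heights are demanded only between
    interior hexagons, which leaves the edges of the boundary cycle free to absorb a correction. *)

Lemma ex_min_nat (T : Type) (P : T -> Prop) (f : T -> nat) :
  (exists x, P x) -> exists x, P x /\ forall y, P y -> f x <= f y.
Proof.
case=> x; have [n] := ubnP (f x); elim: n x => // n IH x fx Px.
case: (classic (exists y, P y /\ f y < f x)) => [[y [Py fy]]|no].
  by apply: (IH y) => //; lia.
exists x; split=> // y Py; rewrite leqNgt; apply/negP => h; apply: no.
by exists y.
Qed.

Lemma fset_argmin (T : choiceType) (X : {fset T}) (h : T -> int) : X != fset0 ->
  exists x, x \in X /\ forall y, y \in X -> (h x <= h y)%R.
Proof.
case/fset0Pn=> x0 x0X.
have [B HB] : exists B : int, forall y, y \in enum_fset X -> (B <= h y)%R.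
  elim: (enum_fset X) => [|a l [B HB]]; first by exists 0%R.
  exists (Num.min B (h a)) => y; rewrite inE ge_min => /orP[/eqP->|/HB->//].
  by rewrite lexx orbT.
have [x [xX hx]] := @ex_min_nat T (fun x => x \in X) (fun x => `|h x - B|%N)
  (ex_intro _ x0 x0X).
exists x; split=> // y yX; move: (hx y yX) (HB y yX) (HB x xX).
by move: (h x) (h y) => a b; clear; lia.
Qed.

Section DirectedCuts.
Variables (K A : choiceType) (I : {fset K}) (E : {fset A}) (tl hd : A -> K).

(* A directed cut is encoded as [(b, s)], where [s] does not contain the outer
   face: no arc enters [s] if [b = true], and no arc leaves it if [b = false]. *)
Definition crosses (e : A) (W : bool * {fset K}) : bool :=
  (tl e \in W.2) != (hd e \in W.2).

Definition dicut (W : bool * {fset K}) : bool :=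
  [&& W.2 != fset0, W.2 `<=` I &
      all (fun e => if W.1 then (hd e \in W.2) ==> (tl e \in W.2)
                    else (tl e \in W.2) ==> (hd e \in W.2)) E].

Definition load (F : seq (bool * {fset K})) (e : A) : nat :=
  \sum_(W <- F) crosses e W.

Definition packing (w : A -> nat) (F : seq (bool * {fset K})) : bool :=
  all dicut F && all (fun e => load F e <= w e) E.

Definition nested (s t : {fset K}) : bool :=
  [|| s `<=` t, t `<=` s | s `&` t == fset0].

(** The function [x * (2N - x)] is strictly concave and increases up to [N], the size of [I].
    Concavity makes it drop when two sets are replaced by their intersection and union, monotonicity
    when they are replaced by their differences; the sum of the cardinalities would not drop in the
    first case. *)
Definition weight (W : bool * {fset K}) : nat :=
  #|` W.2| * (#|` I| + #|` I| - #|` W.2|).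

Definition total_weight (F : seq (bool * {fset K})) : nat :=
  \sum_(W <- F) weight W.

Lemma dicutP (W : bool * {fset K}) :
  reflect [/\ W.2 != fset0, W.2 `<=` I &
     forall e, e \in E -> if W.1 then hd e \in W.2 -> tl e \in W.2
                          else tl e \in W.2 -> hd e \in W.2] (dicut W).
Proof.
apply: (iffP and3P) => [[h1 h2 /allP h3]|[h1 h2 h3]]; split => //.
  by move=> e eE; move: (h3 e eE); case: W.1 => /implyP.
by apply/allP => e eE; move: (h3 e eE); case: W.1 => /implyP.
Qed.

Lemma packingP (w : A -> nat) (F : seq (bool * {fset K})) :
  reflect ((forall W, W \in F -> dicut W) /\
           (forall e, e \in E -> load F e <= w e)) (packing w F).
Proof.
by apply: (iffP andP) => -[h1 h2]; split; try exact/allP.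
Qed.

Lemma load_cons W F e : load (W :: F) e = crosses e W + load F e.
Proof. by rewrite /load big_cons. Qed.

Lemma load_cat F G e : load (F ++ G) e = load F e + load G e.
Proof. by rewrite /load big_cat. Qed.

Lemma perm_load F G e : perm_eq F G -> load F e = load G e.
Proof. by move=> h; rewrite /load (perm_big _ h). Qed.

Lemma perm_packing w F G : perm_eq F G -> packing w F = packing w G.
Proof.
move=> h; rewrite /packing (perm_all _ h); congr andb.
by apply: eq_all => e; rewrite (perm_load e h).
Qed.

(** Cuts of the same kind are closed under intersection and union. For opposite kinds the complement
    of [t] is of the kind of [s]; intersecting and uniting [s] with it, and complementing the union
    to avoid the outer face again, gives the two differences. *)
Lemma uncross (W1 W2 : bool * {fset K}) :
  dicut W1 -> dicut W2 -> ~~ nested W1.2 W2.2 ->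
  exists W1' W2', [/\ dicut W1', dicut W2',
    (forall e, e \in E ->
       crosses e W1' + crosses e W2' = crosses e W1 + crosses e W2) &
    weight W1' + weight W2' < weight W1 + weight W2].
Proof.
case: W1 => b1 s; case: W2 => b2 t /dicutP[/= s0 sI sE] /dicutP[/= t0 tI tE].
rewrite /nested /= !negb_or => /and3P[nst nts ist].
have cU := cardfsUI s t; have cs := cardfsID t s; have ct := cardfsID s t.
have sd : s `\` t != fset0 by rewrite fsetD_eq0.
have td : t `\` s != fset0 by rewrite fsetD_eq0.
move: (ist) (sd) (td); rewrite -!cardfs_gt0 => iP sP tP.
rewrite [t `&` s]fsetIC in ct.
have uI : s `|` t `<=` I by rewrite fsubUset sI.
have cI := fsubset_leq_card uI; have csI := fsubset_leq_card sI.
have ctI := fsubset_leq_card tI.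
case: (eqVneq b1 b2) => [eb|nb].
  subst b2.
  exists (b1, s `&` t), (b1, s `|` t); split.
  - apply/dicutP; split => //=; first exact: fsubset_trans (fsubsetIl _ _) sI.
    move=> e eE; move: (sE e eE) (tE e eE); rewrite !inE.
    by case: b1 {sE tE} => h1 h2 /andP[h3 h4]; rewrite h1 // h2.
  - apply/dicutP; split => //=.
      by case/fset0Pn: s0 => x xs; apply/fset0Pn; exists x; rewrite inE xs.
    move=> e eE; move: (sE e eE) (tE e eE); rewrite !inE.
    by case: b1 {sE tE} => h1 h2 /orP[/h1|/h2] ->; rewrite ?orbT.
  - move=> e eE; move: (sE e eE) (tE e eE); rewrite /crosses !inE /=.
    case: (tl e \in s); case: (hd e \in s); case: (tl e \in t);
    case: (hd e \in t); case: b1 {sE tE} => //= h1 h2;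
    by [have := h1 isT | have := h2 isT].
  - rewrite /weight /=.
    move: (#|` s `&` t|) (#|` s `|` t|) (#|` s|) (#|` t|) (#|` s `\` t|)
          (#|` t `\` s|) (#|` I|) cU cs ct iP sP tP cI csI ctI => a b c d p q N.
    move=> e1 e2 e3 p0 q0 t0' l1 l2 l3; clear -e1 e2 e3 p0 q0 t0' l1.
    have ec : c = a + p by lia.
    have ed : d = a + q by lia.
    have eb : b = a + p + q by lia.
    have [r eN] : exists r, N = b + r by exists (N - b); lia.
    subst N b c d.
    have -> : (a + p + q + r + (a + p + q + r) - a = a + p + p + q + q + r + r)%N by lia.
    have -> : (a + p + q + r + (a + p + q + r) - (a + p + q) = a + p + q + r + r)%N by lia.
    have -> : (a + p + q + r + (a + p + q + r) - (a + p) = a + p + q + q + r + r)%N by lia.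
    have -> : (a + p + q + r + (a + p + q + r) - (a + q) = a + p + p + q + r + r)%N by lia.
    nia.
exists (b1, s `\` t), (b2, t `\` s); split.
- apply/dicutP; split => //=; first exact: fsubset_trans (fsubsetDl _ _) sI.
  move=> e eE; move: (sE e eE) (tE e eE) nb; rewrite !inE.
  case: (tl e \in s); case: (hd e \in s); case: (tl e \in t);
  case: (hd e \in t); case: b1 {sE tE}; case: b2 => //= h1 h2;
    by [have := h1 isT | have := h2 isT].
- apply/dicutP; split => //=; first exact: fsubset_trans (fsubsetDl _ _) tI.
  move=> e eE; move: (sE e eE) (tE e eE) nb; rewrite !inE.
  case: (tl e \in s); case: (hd e \in s); case: (tl e \in t);
  case: (hd e \in t); case: b1 {sE tE}; case: b2 => //= h1 h2;
    by [have := h1 isT | have := h2 isT].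
- move=> e eE; move: (sE e eE) (tE e eE) nb; rewrite /crosses !inE /=.
  case: (tl e \in s); case: (hd e \in s); case: (tl e \in t);
  case: (hd e \in t); case: b1 {sE tE}; case: b2 => //= h1 h2;
    by [have := h1 isT | have := h2 isT].
- rewrite /weight /=.
  move: (#|` s `&` t|) (#|` s `|` t|) (#|` s|) (#|` t|) (#|` s `\` t|)
        (#|` t `\` s|) (#|` I|) cU cs ct iP sP tP cI csI ctI => a b c d p q N.
  move=> e1 e2 e3 p0 q0 t0' l1 l2 l3; clear -e1 e2 e3 p0 q0 t0' l1.
  have ec : c = a + p by lia.
  have ed : d = a + q by lia.
  have [r eN] : exists r, N = a + p + q + r by exists (N - b); lia.
  subst N c d.
  have -> : (a + p + q + r + (a + p + q + r) - p = a + a + p + q + q + r + r)%N by lia.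
  have -> : (a + p + q + r + (a + p + q + r) - q = a + a + p + p + q + r + r)%N by lia.
  have -> : (a + p + q + r + (a + p + q + r) - (a + p) = a + p + q + q + r + r)%N by lia.
  have -> : (a + p + q + r + (a + p + q + r) - (a + q) = a + p + p + q + r + r)%N by lia.
  nia.
Qed.

Lemma min_weight_nested w F :
  packing w F ->
  (forall G, size G = size F -> packing w G -> total_weight F <= total_weight G) ->
  forall W1 W2 F', perm_eq F (W1 :: W2 :: F') -> nested W1.2 W2.2.
Proof.
move=> pF minF W1 W2 F' eF; apply/negPn/negP => nn.
have pF' := pF; rewrite (perm_packing w eF) in pF'.
case/packingP: pF' => vF lF.
have d1 : dicut W1 by apply: vF; rewrite inE eqxx.
have d2 : dicut W2 by apply: vF; rewrite !inE eqxx orbT.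
have [W1' [W2' [d1' d2' cE wE]]] := uncross d1 d2 nn.
have /minF : size (W1' :: W2' :: F') = size F by rewrite (perm_size eF).
rewrite /total_weight (perm_big _ eF) !big_cons /= => h.
suff /h : packing w (W1' :: W2' :: F') by lia.
apply/packingP; split=> [W|e eE].
  by rewrite !inE => /or3P[/eqP->|/eqP->|WF] //; apply: vF; rewrite !inE WF !orbT.
by have := lF e eE; rewrite !load_cons !addnA cE.
Qed.

(** The signs are chosen so that every crossing lowers the sum by one in the direction of the arc,
    which turns the load into a potential difference. *)
Definition signed_sum (F : seq (bool * {fset K})) (u : K) : int :=
  (\sum_(W <- F) (if W.1 then (u \in W.2)%:Z else - (u \in W.2)%:Z))%R.

Lemma signed_sum_cons W F u : (signed_sum (W :: F) u =
  (if W.1 then (u \in W.2)%:Z else - (u \in W.2)%:Z) + signed_sum F u)%R.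
Proof. by rewrite /signed_sum big_cons. Qed.

Lemma signed_sum_load F e : e \in E -> all dicut F ->
  ((load F e)%:Z = signed_sum F (tl e) - signed_sum F (hd e))%R.
Proof.
move=> eE; elim: F => [|W F IH] /=; first by rewrite /load /signed_sum !big_nil.
case/andP=> /dicutP[_ _ /(_ e eE) hW] /IH; rewrite load_cons !signed_sum_cons.
rewrite /crosses; case: W.1 hW; case: (tl e \in W.2); case: (hd e \in W.2) => /= h;
  try (by have := h isT); lia.
Qed.

(* Removing a smallest set from a nested family leaves a family whose signed
   sum is constant on that set, so the sign of the set can be chosen freely. *)
Lemma nested_split (F : seq (bool * {fset K})) :
  (forall W1 W2 F', perm_eq F (W1 :: W2 :: F') -> nested W1.2 W2.2) ->
  exists F1 F2, perm_eq F (F1 ++ F2) /\ forall u,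
    (signed_sum F1 u - signed_sum F2 u = 0)%R \/
    (signed_sum F1 u - signed_sum F2 u = 1)%R.
Proof.
have [n] := ubnP (size F); elim: n F => // n IH F szF nF.
case: (altP (F =P [::])) => [->|F0].
  by exists [::], [::]; split=> // u; left; rewrite subrr.
have [X [XF minX]] : exists X, X \in F /\ forall Y, Y \in F -> #|` X.2| <= #|` Y.2|.
  apply: ex_min_nat; case: F F0 {nF szF} => // X F _; exists X.
  by rewrite inE eqxx.
have eF := perm_to_rem XF; set F' := rem X F in eF.
have sF' : size F' < n by move: szF; rewrite (perm_size eF) /= ltnS.
have nF' W1 W2 G : perm_eq F' (W1 :: W2 :: G) -> nested W1.2 W2.2.
  move=> h; apply: (nF W1 W2 (X :: G)); apply: perm_trans eF _.
  have h2 : perm_eq (X :: F') (X :: W1 :: W2 :: G) by rewrite perm_cons.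
  by apply: perm_trans h2 _; apply/permPl/(perm_catCA [:: X] [:: W1; W2] G).
have sup Y : Y \in F' -> (X.2 `&` Y.2 != fset0) -> X.2 `<=` Y.2.
  move=> YF' i0; have eF' := perm_to_rem YF'.
  have : nested X.2 Y.2.
    apply: (nF X Y (rem Y F')); apply: perm_trans eF _; by rewrite perm_cons.
  case/or3P => // [YX|]; last by rewrite (negPf i0).
  have YF : Y \in F by rewrite (perm_mem eF) inE YF' orbT.
  have [_] := fsubset_leqif_cards YX.
  by rewrite eqn_leq minX // fsubset_leq_card //= => /esym/eqP ->.
have cst F1 u v : {subset F1 <= F'} -> u \in X.2 -> v \in X.2 ->
    signed_sum F1 u = signed_sum F1 v.
  move=> sF1 uX vX; rewrite /signed_sum; apply: eq_big_seq => Y YF1.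
  suff -> : (u \in Y.2) = (v \in Y.2) by [].
  have key x y : x \in X.2 -> y \in X.2 -> x \in Y.2 -> y \in Y.2.
    move=> xX yX xY; apply: (fsubsetP (sup Y (sF1 _ YF1) _)) => //.
    by apply/fset0Pn; exists x; rewrite inE xX.
  by apply/idP/idP; apply: key.
have [F1 [F2 [eF12 hF]]] := IH F' sF' nF'.
have s1 : {subset F1 <= F'} by move=> y; rewrite (perm_mem eF12) mem_cat => ->.
have s2 : {subset F2 <= F'}.
  by move=> y; rewrite (perm_mem eF12) mem_cat orbC => ->.
have p1 : perm_eq F ((X :: F1) ++ F2).
  by apply: perm_trans eF _; rewrite /= perm_cons.
have p2 : perm_eq F (F1 ++ (X :: F2)).
  by apply: perm_trans p1 _; rewrite -(cat1s X F2) perm_sym perm_catCA.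
case: (altP (X.2 =P fset0)) => [X0|/fset0Pn[v vX]].
  exists (X :: F1), F2; split=> // u; rewrite signed_sum_cons X0 inE.
  by have := hF u; case: X.1; rewrite /= ?oppr0 add0r.
(* On [X] the difference is constant: if it is 0, [X] joins the side where it raises it to 1,
   otherwise the side where it lowers it to 0. *)
case: (hF v) => h.
  exists (if X.1 then X :: F1 else F1), (if X.1 then F2 else X :: F2).
  split; first by case: X.1.
  move=> u; have := hF u; case: (boolP (u \in X.2)) => uX.
    move: h; rewrite -(cst F1 u v) // -(cst F2 u v) //.
    case eX: X.1; rewrite signed_sum_cons eX uX /=;
      move: (signed_sum F1 u) (signed_sum F2 u); clear; lia.
  case eX: X.1; rewrite signed_sum_cons eX (negPf uX) /=;
    move: (signed_sum F1 u) (signed_sum F2 u); clear; lia.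
exists (if X.1 then F1 else X :: F1), (if X.1 then X :: F2 else F2).
split; first by case: X.1.
move=> u; have := hF u; case: (boolP (u \in X.2)) => uX.
  move: h; rewrite -(cst F1 u v) // -(cst F2 u v) //.
  case eX: X.1; rewrite signed_sum_cons eX uX /=;
    move: (signed_sum F1 u) (signed_sum F2 u); clear; lia.
case eX: X.1; rewrite signed_sum_cons eX (negPf uX) /=;
  move: (signed_sum F1 u) (signed_sum F2 u); clear; lia.
Qed.

(** In a nested packing the two halves have signed sums differing by 0 or 1 everywhere, so on each
    arc their loads differ by at most one; as they add up to at most [w e + w e], each is at most
    [w e]. *)
Lemma packing_halve w F :
  packing (fun e => w e + w e) F ->
  exists G, packing w G /\ size F <= size G + size G.
Proof.
move=> pF.
have [G [[sG pG] minG]] := @ex_min_nat (seq (bool * {fset K}))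
  (fun G => size G = size F /\ packing (fun e => w e + w e) G) total_weight
  (ex_intro _ F (conj (erefl _) pF)).
have nG := min_weight_nested pG (fun G' h1 h2 => minG G' (conj (etrans h1 sG) h2)).
have [F1 [F2 [eG hG]]] := nested_split nG.
rewrite (perm_packing _ eG) in pG; case/packingP: pG => vG lG.
have v1 : all dicut F1 by apply/allP => W h; apply: vG; rewrite mem_cat h.
have v2 : all dicut F2 by apply/allP => W h; apply: vG; rewrite mem_cat h orbT.
have l12 e : e \in E -> load F1 e <= w e /\ load F2 e <= w e.
  move=> eE; have := lG e eE; rewrite load_cat /= => hl.
  have := signed_sum_load eE v1; have := signed_sum_load eE v2.
  move: (hG (tl e)) (hG (hd e)) hl. lia.
rewrite -sG (perm_size eG) size_cat; case: (leqP (size F1) (size F2)) => h.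
  exists F2; split; last by rewrite leq_add2r.
  by apply/packingP; split; [exact/allP | move=> e /l12[]].
exists F1; split; last by rewrite leq_add2l ltnW.
by apply/packingP; split; [exact/allP | move=> e /l12[]].
Qed.

(** A cut crossed by no arc could be repeated at will, and packings would have no maximum. *)
Hypothesis dicut_crossed : forall W, dicut W -> exists2 e, e \in E & crosses e W.

Lemma size_packing w F : packing w F -> size F <= \sum_(e <- E) w e.
Proof.
case/packingP=> vF lF; apply: (@leq_trans (\sum_(e <- E) load F e)); last first.
  by rewrite !big_seq; apply: leq_sum => e /lF.
rewrite /load exchange_big /= -sum1_size big_seq [X in _ <= X]big_seq.
apply: leq_sum => W WF; have [e eE cW] := dicut_crossed (vF W WF).
by rewrite (big_rem e) //= cW.
Qed.

Lemma ex_max_packing w :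
  exists F, packing w F /\ forall G, packing w G -> size G <= size F.
Proof.
have p0 : packing w [::] by apply/packingP; split=> // e _; rewrite /load big_nil.
have [F [pF mF]] := @ex_min_nat _ (packing w)
  (fun F => \sum_(e <- E) w e - size F) (ex_intro _ [::] p0).
exists F; split=> // G pG; have := mF G pG.
by have := size_packing pG; have := size_packing pF; lia.
Qed.

Lemma packing_le w w' F :
  (forall e, e \in E -> w e <= w' e) -> packing w F -> packing w' F.
Proof.
move=> h /packingP[v l]; apply/packingP; split=> // e eE.
exact: leq_trans (l e eE) (h e eE).
Qed.

(* Lovasz's argument: raise the capacities one unit at a time until the packing
   number first jumps, at an arc [b].  If forbidding [b] did not lower the packing
   number, an optimal packing avoiding [b] and one of the jumped capacity
   would together halve to a packing beating the optimum. *)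
Lemma capacity_jump (T : {fset A}) (nu : nat) :
  (forall G, packing (fun e => e \in T) G -> size G <= nu) ->
  (exists2 F, packing (fun e => e \in T) F & F != [::]) ->
  exists2 b, b \in T & forall G, packing (fun e => e \in T `\ b) G -> size G < nu.
Proof.
move=> max1 [[//|W F0] pF _].
have dW : dicut W by case/packingP: pF => h _; apply: h; rewrite inE eqxx.
have cW e : e \in E -> crosses e W -> e \in T.
  move=> eE cr; case/packingP: pF => _ /(_ e eE); rewrite load_cons cr.
  by case: (e \in T).
pose big (l : seq A) := fun e => (e \in T) * (1 + count_mem e l).
(* With [nu] extra units on every arc of [T], [nu + 1] copies of the single cut [W] fit, so the jump
   has happened by then. *)
pose l0 := flatten (nseq nu (enum_fset T)).
have big_end : exists2 G, packing (big l0) G & nu < size G.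
  exists (nseq nu.+1 W); last by rewrite size_nseq.
  apply/packingP; split=> [V /nseqP[-> _]//|e eE].
  have -> : load (nseq nu.+1 W) e = nu.+1 * crosses e W.
    by rewrite /load big_nseq iter_addn addn0 mulnC.
  case cr: (crosses e W); last by rewrite muln0.
  rewrite muln1 /big (cW e eE cr) mul1n add1n ltnS /l0 count_flatten map_nseq sumnE.
  rewrite big_nseq iter_addn addn0 count_uniq_mem ?fset_uniq //.
  by rewrite (cW e eE cr) mul1n.
have big0 G : packing (big [::]) G -> size G <= nu.
  move=> pG; apply: max1; apply: packing_le pG => e _.
  by rewrite /big /= addn0 muln1.
have [l [b [bT low [H1 pH1 szH1]]]] : exists l b, [/\ b \in T,
    (forall G, packing (big l) G -> size G <= nu) &
    (exists2 G, packing (big (b :: l)) G & nu < size G)].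
  have sl0 : {subset l0 <= T} by move=> e /flattenP[s /nseqP[-> _]].
  elim: l0 sl0 big_end => [|b l IH] sl [G pG szG].
    by have := big0 G pG; lia.
  case: (classic (exists2 G, packing (big l) G & nu < size G)) => [h|h].
    by apply: IH => // e el; apply: sl; rewrite inE el orbT.
  exists l, b; split; first by apply: sl; rewrite inE eqxx.
    by move=> G' pG'; rewrite leqNgt; apply/negP => h'; apply: h; exists G'.
  by exists G.
exists b => // G pG; rewrite ltnNge; apply/negP => szG.
(* At [b] the family [G] contributes nothing, which pays for the extra unit of [H1]; at the other
   arcs of [T], [G] uses at most one unit and [H1] at most [big l e]. *)
have pGH : packing (fun e => big l e + big l e) (G ++ H1).
  case/packingP: pG => vG lG; case/packingP: pH1 => vH lH.
  apply/packingP; split=> [V|e eE].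
    by rewrite mem_cat => /orP[/vG|/vH].
  rewrite load_cat; have := lG e eE; have := lH e eE; rewrite /big !inE /=.
  by case: (eqVneq e b) => [->|ne]; rewrite ?bT ?eqxx /=; case: (e \in T) => /=; lia.
have [H [pH szH]] := packing_halve pGH.
have := low H pH; rewrite size_cat in szH; lia.
Qed.

(** Only cuts crossed by arcs of [T] alone are considered, which permits induction on [T]. Deleting
    the arc [b] of a capacity jump costs at least one packed cut, and adding [b] to the smaller
    transversal meets the cuts that were discarded. *)
Theorem lucchesi_younger (T : {fset A}) :
  exists F S, [/\ packing (fun e => e \in T) F, S `<=` T, #|` S| <= size F &
    forall W, dicut W -> (forall e, e \in E -> crosses e W -> e \in T) ->
       exists2 e, e \in S & crosses e W].
Proof.
have [n] := ubnP #|` T|; elim: n T => // n IH T szT.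
have [F [pF maxF]] := ex_max_packing (fun e => e \in T).
case: (altP (F =P [::])) => [F0|F0].
  exists F, fset0; split=> //; rewrite ?fsub0set ?cardfs0 // => W dW cW.
  suff /maxF : packing (fun e => e \in T) [:: W] by rewrite F0.
  apply/packingP; split=> [V|e eE]; first by rewrite inE => /eqP ->.
  rewrite load_cons /load big_nil addn0.
  by case cr: (crosses e W) => //; rewrite (cW e eE cr).
have [b bT hb] := capacity_jump maxF (ex_intro2 _ _ F pF F0).
have [|F' [S [pF' sST szS hS]]] := IH (T `\ b).
  by have := cardfsD1 b T; rewrite bT; lia.
exists F, (b |` S); split=> //.
- apply/fsubsetP => e; rewrite !inE => /orP[/eqP->//|/(fsubsetP sST)].
  by rewrite !inE => /andP[].
- rewrite cardfsU1; apply: leq_trans (hb F' pF').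
  by apply: leq_trans (leq_add (leq_b1 _) szS) _; rewrite add1n.
- move=> W dW cW; case: (boolP (crosses b W)) => cb.
    by exists b; rewrite ?inE ?eqxx.
  have [e eE cr|e eS cr] := hS W dW.
    by rewrite !inE cW // andbT; apply: contraNneq cb => <-.
  by exists e; rewrite ?inE ?eS ?orbT.
Qed.

End DirectedCuts.

(** * Matchings and the dual digraph *)

Inductive dir := D0 | D1 | D2.
Definition nat_of_dir (i : dir) : nat :=
  match i with D0 => 0 | D1 => 1 | D2 => 2 end.
Definition dir_of_nat (n : nat) : dir :=
  match n with 0 => D0 | 1 => D1 | _ => D2 end.
Lemma nat_of_dirK : cancel nat_of_dir dir_of_nat.
Proof. by case. Qed.
HB.instance Definition _ := Countable.copy dir (can_type nat_of_dirK).

Definition dirs : seq dir := [:: D0; D1; D2].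

Definition third (i k : dir) : dir :=
  match i, k with
  | D0, D1 | D1, D0 => D2
  | D0, D2 | D2, D0 => D1
  | _, _ => D0
  end.

(** The three vectors sum to zero, so two steps in different directions make one backward step in
    the third. *)
Definition dir_vec (s : bool) (i : dir) : pt :=
  (let e : int := if s then 1 else -1 in
   match i with D0 => (e, e) | D1 => (e, - e) | D2 => (- (e + e), 0) end)%R.

(* The dual digraph on the hexagons has an arc [f -> nx s f i] across each
   lattice edge; [s] is the choice of orientation, so [nx (~~ s)] steps
   backwards along the arcs. *)
Definition nx (s : bool) (f : pt) (i : dir) : pt :=
  (f.1 - (dir_vec s i).1, f.2 - (dir_vec s i).2)%R.

Lemma nxK s f i : nx (~~ s) (nx s f i) i = f.
Proof. by case: f => x y; case: s; case: i; congr pair; rewrite /=; lia. Qed.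

Lemma nxKn s f i : nx s (nx (~~ s) f i) i = f.
Proof. by have := nxK (~~ s) f i; rewrite negbK. Qed.

Lemma nx_nx s f i k : i != k -> nx s (nx s f i) k = nx (~~ s) f (third i k).
Proof.
by case: f => x y; case: s; case: i; case: k => // _; congr pair; rewrite /=; lia.
Qed.

Lemma nx_neq s f i : (nx s f i == f) = false.
Proof.
by apply/negP => /eqP; case: f => x y; case: s; case: i => -[] /=; lia.
Qed.

Lemma nx_injl s i : injective (fun f => nx s f i).
Proof. by move=> f g h; rewrite -(nxK s f i) h nxK. Qed.

Lemma nx_injr s f i k : nx s f i = nx s f k -> i = k.
Proof. by case: f => x y; case: s; case: i; case: k => // -[] /=; lia. Qed.

Lemma thirdK i k : i != k -> third k (third i k) = i.
Proof. by case: i; case: k. Qed.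

Lemma thirdC i k : third i k = third k i.
Proof. by case: i; case: k. Qed.

Lemma third_neq i k : i != k -> (third i k != i) /\ (third i k != k).
Proof. by case: i; case: k. Qed.

Lemma other_dir (i : dir) : exists k, i != k.
Proof. by case: i; [exists D1 | exists D0 | exists D0]. Qed.

Definition hd (s : bool) (e : pt * dir) : pt := nx s e.1 e.2.

(* [m f i] says that the lattice edge crossed by the arc [f -> nx s f i] is
   matched; the second condition is the covering of the lattice vertex around
   which the hexagons [f], [nx s f i] and [nx (~~ s) f (third i k)] meet. *)
Definition matching (s : bool) (I : {fset pt}) (m : pt -> dir -> bool) : Prop :=
  (forall f i, m f i -> (f \in I) || (nx s f i \in I)) /\
  (forall f i k, f \in I -> i != k ->
     m f i + m (nx s f i) k + m (nx (~~ s) f (third i k)) (third i k) = 1).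

Definition all_arcs (s : bool) (I : {fset pt}) : seq (pt * dir) :=
  [seq (f, i) | f <- I, i <- dirs] ++ [seq (nx (~~ s) f i, i) | f <- I, i <- dirs].

Definition free_arcs (s : bool) (I : {fset pt}) (m : pt -> dir -> bool) :
  {fset pt * dir} :=
  [fset e in all_arcs s I | ~~ m e.1 e.2].

Lemma mem_dirs i : i \in dirs.
Proof. by case: i. Qed.

Lemma mem_all_arcs s I f i :
  ((f, i) \in all_arcs s I) = (f \in I) || (nx s f i \in I).
Proof.
rewrite mem_cat; congr orb.
  apply/allpairsP/idP => [[[g k] /= [gI _ [-> _]]]//|fI].
  by exists (f, i); rewrite mem_dirs.
apply/allpairsP/idP => [[[g k] /= [gI _ [-> ->]]]|fI]; first by rewrite nxKn.
by exists (nx s f i, i); rewrite mem_dirs nxK.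
Qed.

Lemma mem_free_arcs s I m f i : ((f, i) \in free_arcs s I m) =
  ~~ m f i && ((f \in I) || (nx s f i \in I)).
Proof. by rewrite -mem_all_arcs !inE /= andbC. Qed.

Notation cut s I m := (@dicut _ _ I (free_arcs s I m) fst (hd s)).
Notation cross s := (@crosses pt (pt * dir)%type fst (hd s)).
Notation pack s I m :=
  (@packing _ _ I (free_arcs s I m) fst (hd s) (fun=> 1)).
Notation ld s := (@load pt (pt * dir)%type fst (hd s)).

Section Matching.
Variables (s : bool) (I : {fset pt}) (m : pt -> dir -> bool).
Hypothesis Hm : matching s I m.

(** An arc with both ends outside [I] cannot meet a subset of [I], so the condition may range over
    all free arcs of the lattice. *)
Lemma cutP (W : bool * {fset pt}) :
  reflect [/\ W.2 != fset0, W.2 `<=` I &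
    forall f i, ~~ m f i -> if W.1 then nx s f i \in W.2 -> f \in W.2
                           else f \in W.2 -> nx s f i \in W.2] (cut s I m W).
Proof.
apply: (iffP (dicutP _ _ _ _ _)) => -[h1 h2 h3]; split=> //.
  move=> f i nm; have := h3 (f, i); rewrite mem_free_arcs nm /hd /=.
  case: W.1 => /= h hW; apply: h => //.
    by rewrite (fsubsetP h2 _ hW) orbT.
  by rewrite (fsubsetP h2 _ hW).
by case=> f i; rewrite mem_free_arcs => /andP[nm _]; exact: h3.
Qed.

Lemma packP (F : seq (bool * {fset pt})) :
  reflect ((forall W, W \in F -> cut s I m W) /\
           (forall f i, ~~ m f i -> ld s F (f, i) <= 1)) (pack s I m F).
Proof.
apply: (iffP (packingP _ _ _ _ _ _)) => -[h1 h2]; split=> //.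
  move=> f i nm; case: (boolP ((f, i) \in free_arcs s I m)) => [/h2//|].
  rewrite mem_free_arcs nm /= negb_or => /andP[fI nI].
  rewrite /load big_seq big1 // => W /h1/cutP[_ /fsubsetP sW _].
  rewrite /crosses /hd /=.
  by rewrite (contraNF (sW _) fI) (contraNF (sW _) nI).
by case=> f i; rewrite mem_free_arcs => /andP[nm _]; exact: h2.
Qed.

(** Outgoing and incoming sides alternate around a hexagon, and sides of different directions and
    opposite senses are consecutive: they share a vertex. *)
Lemma in_arc_excl f i k : f \in I -> i != k ->
  m f i + m (nx (~~ s) f k) k <= 1.
Proof.
move=> fI ik; have [n1 n2] := third_neq ik.
case: Hm => _ /(_ f i (third i k) fI).
rewrite eq_sym n1 => /(_ isT).
have -> : third i (third i k) = k by rewrite (thirdC i k) thirdK // eq_sym.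
lia.
Qed.

(** The arcs around a lattice vertex form a directed triangle. If a matched arc crossed the cut in
    the same sense as the free ones do, the other two arcs of a triangle would be free and lead back
    across the cut in the forbidden sense. *)
Lemma cross_dir (W : bool * {fset pt}) f i : cut s I m W -> cross s (f, i) W ->
  m f i = (if W.1 then nx s f i \in W.2 else f \in W.2).
Proof.
case: W => b t /cutP[/= _ /fsubsetP tI tE]; rewrite /crosses /hd /=.
have [k ik] := other_dir i; have [n1 n2] := third_neq ik.
case: b tE => tE.
  case: (boolP (nx s f i \in t)) => nt.
    case: (boolP (f \in t)) => // ft _.
    by apply/negPn/negP => /tE/(_ nt); rewrite (negPf ft).
  case: (boolP (f \in t)) => // ft _; apply/negP => mf.
  case: Hm => _ /(_ f i k (tI _ ft) ik); rewrite mf => h.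
  have h1 : ~~ m (nx s f i) k by move: h; case: (m _ k) => //; lia.
  have h2 : ~~ m (nx (~~ s) f (third i k)) (third i k).
    by move: h; case: (m _ (third i k)) => //; lia.
  have := tE _ _ h2; rewrite nxKn => /(_ ft); rewrite -nx_nx // => /(tE _ _ h1).
  by rewrite (negPf nt).
case: (boolP (f \in t)) => ft.
  case: (boolP (nx s f i \in t)) => // nt _.
  by apply/negPn/negP => /tE/(_ ft); rewrite (negPf nt).
case: (boolP (nx s f i \in t)) => // nt _; apply/negP => mf.
have kt : k != third i k by rewrite eq_sym.
case: Hm => _ /(_ _ k (third i k) (tI _ nt) kt); rewrite thirdK // nxK mf => h.
have h1 : ~~ m (nx s f i) k by move: h; case: (m _ k) => //; lia.
have h2 : ~~ m (nx s (nx s f i) k) (third i k).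
  by move: h; case: (m _ (third i k)) => //; lia.
have := tE _ _ h2 (tE _ _ h1 nt).
by rewrite (nx_nx s f ik) nxKn (negPf ft).
Qed.

Definition flip (W : bool * {fset pt}) (f : pt) (i : dir) : bool :=
  m f i (+) cross s (f, i) W.

(** A directed triangle around a vertex crosses the cut either never or once in each sense; by
    [cross_dir] exactly one of these two crossings is matched, so the exchange keeps one matched
    edge at the vertex. *)
Lemma matching_flip W : cut s I m W -> matching s I (flip W).
Proof.
move=> cW; case/cutP: (cW) => _ /fsubsetP WI _; split=> [f i|f i k fI ik].
  rewrite /flip; case mf: (m f i); first by case: Hm => /(_ f i mf).
  rewrite addFb /crosses /hd /=; case: (boolP (f \in W.2)) => [/WI->//|_].
  by case: (boolP (nx s f i \in W.2)) => // /WI->; rewrite orbT.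
have := proj2 Hm f i k fI ik.
have := @cross_dir W f i cW; have := @cross_dir W (nx s f i) k cW.
have := @cross_dir W (nx (~~ s) f (third i k)) (third i k) cW.
rewrite /flip /crosses /hd /= nxKn (nx_nx s f ik).
case: (f \in W.2); case: (nx s f i \in W.2);
  case: (nx (~~ s) f (third i k) \in W.2); case: W.1;
  case: (m f i); case: (m (nx s f i) k);
  case: (m (nx (~~ s) f (third i k)) (third i k)) => //= h1 h2 h3;
  by [have := h1 isT | have := h2 isT | have := h3 isT].
Qed.

Lemma packing_two_crosses F W1 W2 f i : pack s I m F -> ~~ m f i ->
  W1 \in F -> W2 \in F -> W1 != W2 -> cross s (f, i) W1 -> cross s (f, i) W2 ->
  False.
Proof.
case/packP => _ lF nm W1F W2F ne c1 c2; have := lF f i nm.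
have W2F' : W2 \in rem W1 F.
  by move: W2F; rewrite (perm_mem (perm_to_rem W1F)) inE eq_sym (negPf ne).
rewrite (perm_load _ _ _ (perm_to_rem W1F)) load_cons c1.
by rewrite (perm_load _ _ _ (perm_to_rem W2F')) load_cons c2.
Qed.

Lemma packing_mem_uniq F W f i : pack s I m F -> ~~ m f i ->
  cross s (f, i) W -> count_mem W F <= 1.
Proof.
case/packP => _ lF nm cW; apply: leq_trans (lF f i nm).
rewrite /load -sum1_count big_mkcond; apply: leq_sum => V _ /=.
by case: eqP => [->|//]; rewrite cW.
Qed.

Lemma source_cut x : x \in I -> (forall i, m (nx (~~ s) x i) i) ->
  cut s I m (true, [fset x]).
Proof.
move=> xI src; apply/cutP; split=> /=.
- by apply/fset0Pn; exists x; rewrite inE.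
- by apply/fsubsetP => y; rewrite inE => /eqP ->.
- by move=> f i nm; rewrite !inE => /eqP e; move: nm; rewrite -(nxK s f i) e src.
Qed.

Lemma sink_cut x : x \in I -> (forall i, m x i) -> cut s I m (false, [fset x]).
Proof.
move=> xI snk; apply/cutP; split=> /=.
- by apply/fset0Pn; exists x; rewrite inE.
- by apply/fsubsetP => y; rewrite inE => /eqP ->.
- by move=> f i nm; rewrite !inE => /eqP e; move: nm; rewrite e snk.
Qed.

Lemma cut_sink x : cut s I m (false, [fset x]) -> forall i, m x i.
Proof.
case/cutP=> /= _ _ h i; apply/negPn/negP => /h.
by rewrite !inE nx_neq eqxx => /(_ isT).
Qed.

Lemma cut_source x : cut s I m (true, [fset x]) ->
  forall i, m (nx (~~ s) x i) i.
Proof.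
case/cutP=> /= _ _ h i; apply/negPn/negP => /h.
by rewrite nxKn !inE nx_neq eqxx => /(_ isT).
Qed.

Lemma source_out x i : x \in I -> (forall k, m (nx (~~ s) x k) k) -> ~~ m x i.
Proof.
move=> xI src; have [k ik] := other_dir i.
by have := in_arc_excl xI ik; rewrite src; case: (m x i).
Qed.

Lemma sink_in x i : x \in I -> (forall k, m x k) -> ~~ m (nx (~~ s) x i) i.
Proof.
move=> xI snk; have [k ik] := other_dir i; rewrite eq_sym in ik.
by have := in_arc_excl xI ik; rewrite snk; case: (m _ i).
Qed.

End Matching.

(** * Rotating the lowest hexagons of a cut *)

Section Successors.
Variables (s : bool) (Z : {fset pt}).

Definition successors : {fset pt} := 
  [fset q in [seq nx s z i | z <- Z, i <- dirs]].

Lemma successorsP q :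
  reflect (exists z i, z \in Z /\ q = nx s z i) (q \in successors).
Proof.
rewrite inE; apply: (iffP idP) => [h|[z [i [zZ ->]]]].
  by case/allpairsP: h => -[z i] /= [zZ _ ->]; exists z, i.
by apply/allpairsP; exists (z, i); rewrite mem_dirs.
Qed.

Definition xcoord (f : pt) : int := (if s then f.1 else - f.1)%R.

Lemma xcoord_nx f i :
  xcoord (nx s f i) = (xcoord f + if i is D2 then 2 else -1)%R.
Proof. by case: f => x y; rewrite /xcoord; case: s; case: i => /=; lia. Qed.

(** If [G] is empty, one element of [Z] supplies three successors. Otherwise each [g] in [G] yields
    a second successor, via [D1] and [D2], whose coordinate exceeds that of [g]; the second
    successors of an element [g0] of least coordinate via [D0 D0], [D0 D1] and [D1 D1] lie below all
    of these and are three more. *)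
Lemma card_successors (G : {fset pt}) :
  Z != fset0 -> (forall g k, g \in G -> nx s g k \in Z) ->
  #|` G| + 3 <= #|` successors|.
Proof.
move=> /fset0Pn[z zZ] GZ.
have inS x i : x \in Z -> nx s x i \in successors.
  by move=> xZ; apply/successorsP; exists x, i.
case: (altP (G =P fset0)) => [->|G0].
  rewrite cardfs0 add0n.
  have <- : #|` nx s z D0 |` (nx s z D1 |` [fset nx s z D2])| = 3.
    rewrite !cardfsU1 cardfs1 !inE.
    do 3!case: eqP => [/nx_injr//|_]; by [].
  by apply: fsubset_leq_card; rewrite !fsubUset !fsub1set !inS.
pose m0 (f : pt) := xcoord f.
have [g0 [g0G min0]] := fset_argmin m0 G0.
pose P := [fset nx (~~ s) g D0 | g in G].
have cP : #|` P| = #|` G| by rewrite card_imfset //=; exact: nx_injl.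
have xP y : y \in P -> (m0 g0 < m0 y)%R.
  case/imfsetP=> g /= gG ->; have := xcoord_nx (nx (~~ s) g D0) D0; rewrite nxKn.
  by have := min0 g gG; rewrite /m0; lia.
have nP y : (m0 y < m0 g0)%R -> y \notin P.
  by move=> h; apply/negP => /xP; lia.
have x2 i k : i != D2 -> k != D2 -> (m0 (nx s (nx s g0 i) k) < m0 g0)%R.
  by rewrite /m0 !xcoord_nx; case: i; case: k => // _ _; lia.
have card4 : #|` nx s (nx s g0 D0) D0 |` (nx s (nx s g0 D0) D1 |`
    (nx s (nx s g0 D1) D1 |` P))| = #|` G| + 3.
  rewrite !cardfsU1 cP !inE !(negPf (nP _ (x2 _ _ _ _))) // !orbF.
  have -> : (nx s (nx s g0 D0) D0 == nx s (nx s g0 D0) D1) = false.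
    by apply/negP => /eqP /nx_injr.
  have -> : (nx s (nx s g0 D0) D1 == nx s (nx s g0 D1) D1) = false.
    by apply/negP => /eqP /nx_injl /nx_injr.
  have -> : (nx s (nx s g0 D0) D0 == nx s (nx s g0 D1) D1) = false.
    apply/negP; case: g0 {g0G min0 xP nP x2} => x y; rewrite /nx /=.
    by case: s => /= /eqP [] /=; lia.
  by rewrite /=; lia.
rewrite -card4; apply: fsubset_leq_card.
rewrite !fsubUset !fsub1set !inS ?GZ //=.
apply/fsubsetP => y /imfsetP[g /= gG ->].
by rewrite -(@nx_nx s g D1 D2) // inS // GZ.
Qed.

End Successors.

Lemma size_filter_mem (T : eqType) (L F : seq T) :
  (forall y, y \in L -> count_mem y F <= 1) ->
  size (filter (mem L) F) <= size L.
Proof.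
move=> h; apply: uniq_leq_size; last by move=> y; rewrite mem_filter => /andP[].
apply: count_mem_uniq => y; rewrite mem_filter count_filter /=.
case: (boolP (y \in L)) => yL; last first.
  rewrite (eq_count (a2 := pred0)) ?count_pred0 // => x /=.
  by apply/negP => /andP[/eqP->]; rewrite (negPf yL).
rewrite (eq_count (a2 := pred1 y)); last first.
  by move=> x /=; case: eqP => // ->; rewrite yL.
have := h y yL; rewrite -has_pred1 has_count.
by case: (count_mem y F) => [|[]].
Qed.

Lemma one_of_three (a b c : bool) : a + b + c = 1 -> a -> ~~ b /\ ~~ c.
Proof. by case: a; case: b; case: c. Qed.

Lemma singleton_weight a b : 1 < a -> a <= b -> b + b - 1 < a * (b + b - a).
Proof.
move=> ha hb; have [p ep] : exists p, a = 2 + p by exists (a - 2); lia.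
have [r er] : exists r, b = a + r by exists (b - a); lia.
subst; have -> : 2 + p + r + (2 + p + r) - (2 + p) = 2 + p + r + r by lia.
have -> : 2 + p + r + (2 + p + r) - 1 = 3 + p + p + r + r by lia.
nia.
Qed.

Section Improve.
Variables (s : bool) (I : {fset pt}) (m : pt -> dir -> bool).
Hypothesis Hm : matching s I m.
Variable h : pt -> int.
Hypothesis Hh : forall f i, f \in I -> nx s f i \in I ->
  (h (nx s f i) = h f + 1 - (m f i)%:Z * 3)%R.
Variables (X : {fset pt}) (F1 : seq (bool * {fset pt})).
Let F := (true, X) :: F1.
Hypothesis pF : pack s I m F.
Hypothesis minF : forall G, size G = size F -> pack s I m G ->
  total_weight I F <= total_weight I G.
Hypothesis szX : 1 < #|` X|.
Hypothesis minX : forall W, W \in F1 -> 1 < #|` W.2| -> #|` X| <= #|` W.2|.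

Let cutF1 W : W \in F1 -> cut s I m W.
Proof. by move=> WF; case/packP: pF => hc _; apply: hc; rewrite inE WF orbT. Qed.

Let cutX : cut s I m (true, X).
Proof. by case/packP: pF => hc _; apply: hc; rewrite inE eqxx. Qed.

Let XI x : x \in X -> x \in I.
Proof. by case/cutP: cutX => _ /fsubsetP /= hX _; exact: hX. Qed.

Let X_up f i : ~~ m f i -> nx s f i \in X -> f \in X.
Proof. by case/cutP: cutX => _ _ /= hX; exact: hX. Qed.

Let not_both W f i : W \in F1 -> ~~ m f i -> cross s (f, i) W ->
  (f \in X) = (nx s f i \in X).
Proof.
move=> WF nm cW; case/packP: pF => _ /(_ f i nm).
rewrite load_cons (perm_load _ _ _ (perm_to_rem WF)) load_cons cW.
by rewrite /crosses /hd /=; case: (f \in X); case: (nx s f i \in X).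
Qed.

(** Nestedness leaves only a [W] properly contained in [X], and [X] is smallest among the cuts with
    more than one hexagon. *)
Let separated W x y : W \in F1 -> y \in W.2 -> y \in X -> x \in X ->
  x \notin W.2 -> W.2 = [fset y].
Proof.
move=> WF yW yX xX xW.
have : nested X W.2.
  apply: (min_weight_nested pF minF (F' := rem W F1) (W1 := (true, X)) (W2 := W)).
  by rewrite perm_cons perm_to_rem.
case/or3P=> [/fsubsetP/(_ x xX)|sub|/eqP i0].
- by rewrite (negPf xW).
- have : #|` W.2| <= 1.
    rewrite leqNgt; apply/negP => /(minX WF); rewrite leqNgt => /negP; apply.
    by apply: fproper_ltn_card; rewrite fproperE sub; apply/fsubsetPn; exists x.
  have : 0 < #|` W.2| by rewrite cardfs_gt0; apply/fset0Pn; exists y.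
  move=> h1 h2; have /cardfs1P[z e] : #|` W.2| == 1 by rewrite eqn_leq h1 h2.
  by move: yW; rewrite e inE => /eqP ->.
- have : y \in X `&` W.2 by rewrite inE yX.
  by rewrite i0.
Qed.

(** Otherwise the one-hexagon cut at [x] could take the place of [X] at a smaller weight, provided
    no other cut of the packing uses a free arc out of [x]. *)
Let source_in x : x \in X -> (forall i, m (nx (~~ s) x i) i) ->
  (true, [fset x]) \in F1.
Proof.
move=> xX src; apply/negPn/negP => nF.
have xI := XI xX; have cx := source_cut xI src.
have pG : pack s I m ((true, [fset x]) :: F1).
  apply/packP; split=> [W|f i nm].
    by rewrite inE => /orP[/eqP->//|/cutF1].
  rewrite load_cons; case cr: (cross s (f, i) (true, [fset x])); last first.
    case/packP: pF => _ /(_ f i nm); rewrite load_cons.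
    by apply: leq_trans; exact: leq_addl.
  have := cr; rewrite /crosses /hd /= !inE => fx.
  have {}fx : f = x.
    move: fx; case: (eqVneq f x) => // _; case: (eqVneq (nx s f i) x) => // e.
    by move: nm; rewrite -(nxK s f i) e src.
  subst f; suff -> : ld s F1 (x, i) = 0 by [].
  rewrite /load big_seq big1 // => W WF; apply/eqP; rewrite eqb0.
  apply/negP => cW; have qX := not_both WF nm cW; rewrite xX in qX.
  have := cross_dir Hm (cutF1 WF) cW; rewrite (negPf nm).
  have := cW; rewrite /crosses /hd /=; case eb: W.1.
    move=> hx hq; rewrite -hq eqbF_neg negbK in hx.
    have := separated WF hx xX (esym qX); rewrite -hq => /(_ isT) e.
    by move: WF; rewrite (surjective_pairing W) e eb (negPf nF).
  (* Here [W] would be the sink at the head of the arc; a matched outgoing side of it and a matched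
     incoming side of [x] would meet in one vertex. *)
  move=> hq hx; rewrite -hx eq_sym eqbF_neg negbK in hq.
  have e := separated WF hq (esym qX) xX; rewrite -hx in e.
  move: (e isT) => {}e.
  have [k ik] := other_dir i; have kt := third_neq ik.
  have := cutF1 WF; rewrite (surjective_pairing W) e eb => /cut_sink/(_ k) mk.
  by have := proj2 Hm x i k xI ik; rewrite mk src; case: (m x i).
have := minF (erefl : size ((true, [fset x]) :: F1) = size F) pG.
rewrite /total_weight !big_cons leq_add2r leqNgt => /negP; apply.
have XIc : #|` X| <= #|` I| by apply: fsubset_leq_card; apply/fsubsetP => y /XI.
by rewrite /weight /= cardfs1 mul1n; apply: singleton_weight.
Qed.

Variable z0 : pt.
Hypothesis z0X : z0 \in X.
Hypothesis hmin : forall x, x \in X -> (h z0 <= h x)%R.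

Let Z := [fset x in X | h x == h z0].

Let inZ x : (x \in Z) = (x \in X) && (h x == h z0).
Proof. by rewrite !inE. Qed.

(** A free arc into [z] would start inside [X], one unit below the least height. *)
Let Z_source z : z \in Z -> forall i, m (nx (~~ s) z i) i.
Proof.
rewrite inZ => /andP[zX /eqP hz] i; apply/negPn/negP => nm.
have pX : nx (~~ s) z i \in X by apply: (X_up nm); rewrite nxKn.
have := Hh (XI pX) (i := i); rewrite nxKn => /(_ (XI zX)).
by have := hmin pX; rewrite (negPf nm) hz; clear; lia.
Qed.

Let ZX z : z \in Z -> z \in X.
Proof. by rewrite inZ => /andP[]. Qed.

Let ZF z : z \in Z -> (true, [fset z]) \in F1.
Proof. by move=> zZ; apply: source_in (ZX zZ) (Z_source zZ). Qed.

Let Z_out z i : z \in Z -> ~~ m z i.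
Proof. by move=> zZ; apply: (source_out Hm _ (XI (ZX zZ)) (Z_source zZ)). Qed.

Let Z_cross z i : cross s (z, i) (true, [fset z]).
Proof. by rewrite /crosses /hd /= !inE nx_neq eqxx. Qed.

(** The packed source at [z] uses up the arc, so [X] cannot cross it. *)
Let Z_succ z i : z \in Z -> nx s z i \in X.
Proof.
by move=> zZ; rewrite -(not_both (ZF zZ) (Z_out i zZ) (Z_cross z i)) ZX.
Qed.

Let Z_succ_h z i : z \in Z -> (h (nx s z i) = h z0 + 1)%R.
Proof.
move=> zZ; rewrite (Hh (XI (ZX zZ)) (XI (Z_succ i zZ))) (negPf (Z_out i zZ)).
by move: zZ; rewrite inZ => /andP[_ /eqP ->]; clear; lia.
Qed.

Let succ_Z z i : z \in Z -> nx s z i \notin Z.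
Proof. by move=> zZ; rewrite inZ (Z_succ_h i zZ); clear; lia. Qed.

Let Q := successors s Z.

Let QX q : q \in Q -> q \in X /\ (h q = h z0 + 1)%R.
Proof. by case/successorsP=> z [i [zZ ->]]; rewrite Z_succ // Z_succ_h. Qed.

(** For a direction other than that of the arc from [z] to [q], the edge shares a vertex with a
    matched incoming side of [z]. For the same direction, the two free arcs of the triangle would
    put its head in [X], two units below [q] and so below the least height. *)
Let Q_out q k : q \in Q -> ~~ m q k.
Proof.
case/successorsP=> z [i [zZ ->]]; apply/negP => mq.
have zI := XI (ZX zZ); have qX := Z_succ i zZ; have hq := Z_succ_h i zZ.
case: (eqVneq i k) => [ek|ik]; last first.
  by have := proj2 Hm z i k zI ik; rewrite mq Z_source //; case: (m z i).
subst k; set q' := nx s z i in mq qX hq *.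
have [j ij] := other_dir i.
have [n1 n2] := one_of_three (proj2 Hm q' i j (XI qX) ij) mq.
have yX := X_up n2; rewrite nxKn in yX; have {}yX := yX qX.
rewrite -nx_nx // in yX; have xX := X_up n1 yX.
have := Hh (XI qX) (XI xX); rewrite mq hq.
by have := hmin xX; clear; lia.
Qed.

Let Q_in f i : ~~ m f i -> nx s f i \in Q -> f \in Z.
Proof.
move=> nm qQ; have [qX hq] := QX qQ; have fX := X_up nm qX.
rewrite inZ fX /=; have := Hh (XI fX) (XI qX); rewrite hq (negPf nm); clear; lia.
Qed.

Let QZ q : q \in Q -> q \notin Z.
Proof. by case/successorsP=> z [i [zZ ->]]; exact: succ_Z. Qed.

Let G := [fset g in X | all (fun k => nx s g k \in Z) dirs].

Let inG g : g \in G <-> (g \in X /\ forall k, nx s g k \in Z).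
Proof.
rewrite !inE; split=> [/andP[gX /allP hg]|[gX hg]].
  by split=> // k; apply: hg; rewrite mem_dirs.
by rewrite gX /= !hg.
Qed.

Let sink_G g : g \in X -> (h g = h z0 + 2)%R -> (forall k, m g k) -> g \in G.
Proof.
move=> gX hg mg; apply/inG; split=> // k; have [j kj] := other_dir k.
have [n1 n2] := one_of_three (proj2 Hm g k j (XI gX) kj) (mg k).
have pX := X_up n2; rewrite nxKn in pX; have {}pX := pX gX.
rewrite -nx_nx // in pX; have yX := X_up n1 pX.
by rewrite inZ yX; have := Hh (XI gX) (XI yX); rewrite mg hg; clear; lia.
Qed.

(** Some free arc leads to [g] from a hexagon of [Q], hence of [X]; the packed sink uses it, so [X]
    does not, and [g] lies in [X], two units above [Z]. *)
Let lost_G g i : (false, [fset g]) \in F1 -> nx s g i \in Z -> g \in G.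
Proof.
move=> gF zZ; have mg := cut_sink (cutF1 gF).
have [k ik] := other_dir i; have [n1 n2] := third_neq ik.
pose q := nx s (nx s g i) k.
have qQ : q \in Q by apply/successorsP; exists (nx s g i), k.
have qg : nx s q (third i k) = g by rewrite /q (nx_nx s g ik) nxKn.
have gX : g \in X.
  rewrite -qg -(@not_both (false, [fset g]) q) ?Q_out //; first by case: (QX qQ).
  rewrite /crosses /hd /= !inE qg eqxx eqb_id.
  by apply/eqP => e; move: qg; rewrite e => /eqP; rewrite nx_neq.
apply: sink_G => //; have := Hh (XI gX) (XI (ZX zZ)); rewrite mg.
by move: zZ; rewrite inZ => /andP[_ /eqP ->]; clear; lia.
Qed.

Let lost := [seq (true, [fset z]) | z <- Z] ++ [seq (false, [fset g]) | g <- G].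
Let Fs := filter (predC (mem lost)) F1.

Let Fs_in W : W \in Fs -> W \in F1 /\ W \notin lost.
Proof. by rewrite mem_filter => /andP[]. Qed.

Let Fs_Z_out W z i : W \in Fs -> z \in Z -> (nx s z i \in W.2) = (z \in W.2).
Proof.
case/Fs_in=> WF WL zZ; apply/eqP; rewrite eq_sym; apply/negPn/negP => cW.
have pF1 : pack s I m F1.
  case/packP: pF => hc hl; apply/packP; split=> [V|f k nm].
    exact: cutF1.
  by have := hl f k nm; rewrite load_cons; apply: leq_trans; exact: leq_addl.
apply: (packing_two_crosses pF1 (Z_out i zZ) WF (ZF zZ) _ cW (Z_cross z i)).
by apply: contraNneq WL => ->; rewrite mem_cat map_f.
Qed.

(** If [W] separated [z] from a predecessor [p], it would cross the free arc to [p] from a successor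
    [q] of [z], since it keeps [z] and [q] together. By [separated], [W] is then [q] alone, although
    it contains [z], or the sink [p], which is among the lost cuts. *)
Let Fs_Z_in W z i : W \in Fs -> z \in Z ->
  (nx (~~ s) z i \in W.2) = (z \in W.2).
Proof.
move=> WFs zZ; have [WF WL] := Fs_in WFs.
apply/eqP; apply/negPn/negP => cW; pose p := nx (~~ s) z i; rewrite -/p in cW.
have [k ik] := other_dir i; have [n1 n2] := third_neq ik.
pose l := third i k; pose q := nx s z k.
have qQ : q \in Q by apply/successorsP; exists z, k.
have qp : nx s q l = p.
  by rewrite /q nx_nx 1?eq_sym // /l thirdK.
have crq : cross s (q, l) W.
  by rewrite /crosses /hd /= qp Fs_Z_out // eq_sym.
have pX : p \in X.
  by rewrite -qp -(not_both WF (Q_out l qQ) crq); case: (QX qQ).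
have qX : q \in X by case: (QX qQ).
have := cross_dir Hm (cutF1 WF) crq; rewrite (negPf (Q_out l qQ)) qp.
have qW := Fs_Z_out k WFs zZ; rewrite -/q in qW.
case eb: W.1 => e.
  have zW : z \in W.2 by move: cW; rewrite -e; case: (z \in _).
  have := separated WF _ qX pX; rewrite qW zW -e => /(_ isT isT) e'.
  by move: zW; rewrite e' inE => /eqP e2; have := nx_neq s z k; rewrite -/q -e2 eqxx.
have pW : p \in W.2 by move: cW; rewrite -qW -e; case: (p \in _).
have := separated WF pW pX qX; rewrite -e => /(_ isT) e'.
case/negP: WL; rewrite mem_cat; apply/orP; right.
rewrite (surjective_pairing W) e' eb map_f //.
apply: (@lost_G p i); last by rewrite nxKn.
by rewrite -e' -eb -surjective_pairing.
Qed.

Let mz := flip s m (true, Z).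

Let Z_ne : Z != fset0.
Proof. by apply/fset0Pn; exists z0; rewrite inZ z0X /=. Qed.

Let cutZ : cut s I m (true, Z).
Proof.
apply/cutP; split=> //=; first by apply/fsubsetP => z /ZX/XI.
move=> f i nm zZ; move: (Z_source zZ i); rewrite nxK (negPf nm); by [].
Qed.

Let Hmz : matching s I mz.
Proof. exact: matching_flip Hm _ cutZ. Qed.

Let cross_Z f i : cross s (f, i) (true, Z) = (f \in Z) || (nx s f i \in Z).
Proof.
rewrite /crosses /hd /=; case: (boolP (f \in Z)) => fZ.
  by rewrite (negPf (succ_Z i fZ)).
by case: (_ \in Z).
Qed.

Let Fs_not_cross_Z W f i : W \in Fs -> cross s (f, i) (true, Z) ->
  (nx s f i \in W.2) = (f \in W.2).
Proof.
rewrite cross_Z => WF /orP[fZ|nZ]; first exact: Fs_Z_out.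
by have := Fs_Z_in i WF nZ; rewrite nxK.
Qed.

Let new_family := Fs ++ [seq (false, [fset z]) | z <- Z] ++
  [seq (true, [fset q]) | q <- Q].

Let load_singletons (b : bool) (Y : {fset pt}) f i :
  ld s [seq (b, [fset y]) | y <- Y] (f, i) = (f \in Y) + (nx s f i \in Y).
Proof.
rewrite /load big_map /crosses /hd /=.
under eq_bigr => y _ do rewrite !inE.
have one x : \sum_(y <- Y) (x == y) = (x \in Y).
  rewrite -(count_uniq_mem x (fset_uniq Y)) -sum1_count [RHS]big_mkcond /=.
  by apply: eq_bigr => y _; rewrite eq_sym; case: eqP.
rewrite -!one -big_split /=; apply: eq_bigr => y _.
have : ~~ ((f == y) && (nx s f i == y)).
  by apply/andP => -[/eqP <-]; rewrite nx_neq.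
by case: (f == y); case: (nx s f i == y).
Qed.

Let pack_new : pack s I mz new_family.
Proof.
apply/packP; split=> [W|f i nmz].
  rewrite !mem_cat => /or3P[WFs|/mapP[z zZ ->]|/mapP[q qQ ->]].
  - case/cutP: (cutF1 (proj1 (Fs_in WFs))) => W0 WI Wc.
    apply/cutP; split=> // f i; rewrite /mz /flip.
    case: (boolP (cross s (f, i) (true, Z))) => cr.
      by move=> _; rewrite (Fs_not_cross_Z WFs cr); case: W.1.
    by rewrite addbF; exact: Wc.
  - apply: sink_cut; first exact/XI/ZX.
    move=> i; rewrite /mz /flip cross_Z zZ addbT; exact: Z_out.
  - apply: source_cut; first by case: (QX qQ) => /XI.
    move=> i; rewrite /mz /flip cross_Z nxKn (negPf (QZ qQ)) orbF.
    case: (boolP (m (nx (~~ s) q i) i)) => mq.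
      case: (boolP (nx (~~ s) q i \in Z)) => // pZ.
      by have := Z_out i pZ; rewrite mq.
    by have := Q_in mq; rewrite nxKn => /(_ qQ) ->.
rewrite /new_family !load_cat !load_singletons.
(* An arc at [Z] that is free after the rotation was matched before, so it enters [Z]; only the new
   sink at its head uses it. *)
case: (boolP (cross s (f, i) (true, Z))) => cr.
  have -> : ld s Fs (f, i) = 0.
    rewrite /load big_seq big1 // => W WFs; rewrite /crosses /hd /=.
    by rewrite Fs_not_cross_Z // eqxx.
  have mf : m f i by move: nmz; rewrite /mz /flip cr addbT negbK.
  have := cross_dir Hm cutZ cr; rewrite mf /= => /esym nZ.
  have -> : (f \in Z) = false by apply: contraTF mf => fZ; exact: Z_out.
  have -> : (f \in Q) = false by apply: contraTF mf => fQ; exact: Q_out.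
  by rewrite nZ (contraTF (@QZ _) nZ).
have nm : ~~ m f i by move: nmz; rewrite /mz /flip (negPf cr) addbF.
move: (cr); rewrite cross_Z negb_or => /andP[/negPf fZ /negPf ->].
rewrite fZ; have -> : (nx s f i \in Q) = false.
  by apply/negP => /(Q_in nm); rewrite fZ.
rewrite !add0n addn0; case: (boolP (f \in Q)) => fQ; last first.
  rewrite addn0; case/packP: pF => _ /(_ f i nm); rewrite load_cons.
  apply: leq_trans; apply: leq_trans (leq_addl _ _).
  rewrite /load big_filter [X in X <= _]big_mkcond.
  by apply: leq_sum => W _; case: ifP.
suff -> : ld s Fs (f, i) = 0 by [].
(* A surviving cut using a free arc out of [Q] would be a single hexagon by [separated]: either [f],
   which it cannot contain without its predecessor in [Z], or a sink two units above [Z], which was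
   lost. *)
rewrite /load big_seq big1 // => W WFs; apply/eqP; rewrite eqb0; apply/negP => cW.
have [WF WL] := Fs_in WFs; have [fX hf] := QX fQ.
have nX : nx s f i \in X by rewrite -(not_both WF nm cW).
have [z [k [zZ ef]]] : exists z k, z \in Z /\ f = nx s z k by apply/successorsP.
have fW := Fs_Z_out k WFs zZ; rewrite -ef in fW.
have := cross_dir Hm (cutF1 WF) cW; rewrite (negPf nm).
move: cW; rewrite /crosses /hd /=; case eb: W.1 => cW e.
  have {cW} : f \in W.2 by move: cW; rewrite -e; case: (f \in _).
  move=> fW'; have := separated WF fW' fX nX; rewrite -e => /(_ isT) e'.
  move: fW'; rewrite fW e' inE => /eqP e2; have := nx_neq s z k.
  by rewrite -ef -e2 eqxx.
have nW : nx s f i \in W.2 by move: cW; rewrite -e; case: (_ \in _).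
have := separated WF nW nX fX; rewrite -e => /(_ isT) e'.
case/negP: WL; rewrite mem_cat; apply/orP; right.
rewrite (surjective_pairing W) e' eb map_f //.
apply: sink_G => //; first by rewrite (Hh (XI fX) (XI nX)) hf (negPf nm); clear; lia.
by apply: cut_sink; rewrite -e' -eb -surjective_pairing; exact: cutF1.
Qed.

Lemma improve_up : exists m' F', [/\ matching s I m', pack s I m' F' &
  size F + 2 <= size F'].
Proof.
exists mz, new_family; split=> //; rewrite /new_family !size_cat !size_map.
have pF1 : pack s I m F1.
  case/packP: pF => hc hl; apply/packP; split=> [V|f k nm].
    exact: cutF1.
  by have := hl f k nm; rewrite load_cons; apply: leq_trans; exact: leq_addl.
(* Each lost cut crosses a free arc, so capacity one keeps it from being repeated and the loss is at
   most the length of the list. *)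
have : size (filter (mem lost) F1) <= size lost.
  apply: size_filter_mem => y; rewrite mem_cat => /orP[/mapP[z zZ ->]|/mapP[g gG ->]].
    exact: (packing_mem_uniq pF1 (Z_out D0 zZ) (Z_cross z D0)).
  have [gX gZ] := proj1 (inG g) gG.
  have mg k : m g k by have := Z_source (gZ k) k; rewrite nxK.
  apply: (packing_mem_uniq pF1 (sink_in Hm D0 (XI gX) mg)).
  by rewrite /crosses /hd /= nxKn !inE nx_neq eqxx.
rewrite /lost size_cat !size_map => h1.
have h2 : #|` G| + 3 <= #|` Q|.
  by apply: card_successors => // g k /inG[].
have h3 := count_predC (mem lost) F1; rewrite -!size_filter -/Fs in h3.
rewrite /F /= -addn1 -h3.
set a := size _ in h1 *; set b := size Fs; set c := #|` Q| in h2 *.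
set d := #|` G| in h1 h2 *; set e := size Z in h1 *.
by clearbody a b c d e; move: h1 h2; clear; lia.
Qed.

End Improve.

(** * Reversing all arcs *)

Definition reverse_matching (s : bool) (m : pt -> dir -> bool) (f : pt) (i : dir) :
  bool := m (nx (~~ s) f i) i.

Definition reverse_family (F : seq (bool * {fset pt})) : seq (bool * {fset pt}) :=
  [seq (~~ W.1, W.2) | W <- F].

Lemma matching_reverse s I m : matching s I m ->
  matching (~~ s) I (reverse_matching s m).
Proof.
case=> h1 h2; split=> [f i /h1|f i k fI ik]; first by rewrite nxKn orbC.
have [n1 n2] := third_neq ik; rewrite eq_sym in n2.
have := h2 f (third i k) k fI; rewrite eq_sym n2 => /(_ isT).
have -> : third (third i k) k = i by rewrite thirdC thirdK // thirdC.
rewrite /reverse_matching negbK nxK.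
have -> : nx (~~ s) (nx (~~ s) f i) k = nx s f (third i k).
  by rewrite (nx_nx (~~ s) f ik) negbK.
lia.
Qed.

Lemma cut_reverse s I m W : cut s I m W ->
  cut (~~ s) I (reverse_matching s m) (~~ W.1, W.2).
Proof.
case/cutP=> h1 h2 h3; apply/cutP; split=> //= f i /h3.
by rewrite nxKn; case: W.1.
Qed.

Lemma load_reverse s F f i :
  ld (~~ s) (reverse_family F) (f, i) = ld s F (nx (~~ s) f i, i).
Proof.
rewrite /load big_map; apply: eq_bigr => W _.
by rewrite /crosses /hd /= nxKn eq_sym.
Qed.

Lemma pack_reverse s I m F : pack s I m F ->
  pack (~~ s) I (reverse_matching s m) (reverse_family F).
Proof.
case/packP=> hc hl; apply/packP; split=> [W /mapP[V /hc cV ->]|f i nm].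
  exact: cut_reverse.
by rewrite load_reverse hl.
Qed.

Lemma reverse_matchingK s m f i :
  reverse_matching (~~ s) (reverse_matching s m) f i = m f i.
Proof. by rewrite /reverse_matching negbK nxK. Qed.

Lemma eq_pack s I m m' F : (forall f i, m f i = m' f i) ->
  pack s I m F -> pack s I m' F.
Proof.
move=> e /packP[h1 h2]; apply/packP; split=> [W /h1/cutP[a b c]|f i].
  by apply/cutP; split=> // f i; rewrite -e; exact: c.
by rewrite -e; exact: h2.
Qed.

Lemma total_weight_reverse I F : total_weight I (reverse_family F) = total_weight I F.
Proof. by rewrite /total_weight big_map. Qed.

(** The smallest cut with several hexagons may be of either kind. Reversing all arcs exchanges the
    kinds, and negated heights obey the same rule along reversed arcs. *)
Lemma improve s I m (h : pt -> int) F : matching s I m ->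
  (forall f i, f \in I -> nx s f i \in I ->
     (h (nx s f i) = h f + 1 - (m f i)%:Z * 3)%R) ->
  pack s I m F ->
  (forall G, size G = size F -> pack s I m G ->
     total_weight I F <= total_weight I G) ->
  (exists2 W, W \in F & 1 < #|` W.2|) ->
  exists m' F', [/\ matching s I m', pack s I m' F' & size F + 2 <= size F'].
Proof.
move=> Hm Hh pF minF [W0 W0F sz0].
have [X [[XF szX] minX]] := @ex_min_nat _
  (fun W : bool * {fset pt} => W \in F /\ 1 < #|` W.2|) (fun W => #|` W.2|)
  (ex_intro _ W0 (conj W0F sz0)).
have eF := perm_to_rem XF; move: (rem X F) eF => F1 eF.
have min1 W : W \in F1 -> 1 < #|` W.2| -> #|` X.2| <= #|` W.2|.
  by move=> WF w1; apply: minX; split=> //; rewrite (perm_mem eF) inE WF orbT.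
rewrite (perm_packing _ _ _ _ _ eF) in pF.
have min2 G : size G = size (X :: F1) -> pack s I m G ->
    total_weight I (X :: F1) <= total_weight I G.
  rewrite -(perm_size eF) => /minF min2 /min2.
  by rewrite /total_weight (perm_big _ eF).
have X0 : X.2 != fset0 by rewrite -cardfs_gt0 ltnW.
rewrite (perm_size eF); case: X szX minX min1 pF min2 X0 {XF eF} => b X /=.
case: b => szX _ min1 pF min2 X0.
  have [z [zX hz]] := fset_argmin h X0.
  exact: (improve_up Hm Hh pF min2 szX min1 zX hz).
have [z [zX hz]] := fset_argmin (fun f => - h f)%R X0.
have [|||W|m' [F' [Hm' pF' szF']]] := @improve_up (~~ s) I (reverse_matching s m)
  (matching_reverse Hm) (fun f => - h f)%R _ X (reverse_family F1) _ _ szX _ z zX hz.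
- move=> f i fI nI; have := Hh _ i nI; rewrite nxKn => /(_ fI).
  by rewrite /reverse_matching; move: (h f) (h _) (nat_of_bool _); clear; lia.
- exact: (pack_reverse pF).
- move=> G szG pG.
  have pG' : pack s I m (reverse_family G).
    have := pack_reverse pG; rewrite negbK; apply: eq_pack => f i.
    exact: reverse_matchingK.
  rewrite -(total_weight_reverse I G).
  have := min2 (reverse_family G); rewrite {1}/reverse_family size_map szG.
  rewrite /= /reverse_family size_map => /(_ (erefl _) pG').
  by rewrite -(total_weight_reverse _ (_ :: _)).
- by case/mapP=> V VF -> /=; exact: min1 VF.
exists (reverse_matching (~~ s) m'), (reverse_family F'); split.
- by have := matching_reverse Hm'; rewrite negbK.
- by have := pack_reverse pF'; rewrite negbK.
- by move: szF'; rewrite /= /reverse_family !size_map.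
Qed.

(** * The brick wall lattice *)

(* The lattice edge crossed by the arc [f -> nx true f i]. *)
Definition dual_edge (f : pt) (i : dir) : edge :=
  (match i with
   | D0 => (f, false)
   | D1 => ((f.1, f.2 + 1), false)
   | D2 => ((f.1 + 2, f.2), true)
   end)%R.

(* The lattice vertex shared by [f], [nx true f i] and [nx false f (third i k)]. *)
Definition corner (f : pt) (i k : dir) : pt :=
  (match i, k with
   | D1, D2 => (f.1 + 1, f.2 + 1)
   | D2, D0 => (f.1 + 2, f.2)
   | D1, D0 => (f.1, f.2 + 1)
   | D0, D2 => (f.1 + 1, f.2)
   | D2, D1 => (f.1 + 2, f.2 + 1)
   | _, _ => f
   end)%R.

Definition star (v : pt) : seq edge :=
  ([:: (v, false); ((v.1 - 1, v.2), false);
      (if even_pt v then v else (v.1, v.2 - 1), true)])%R.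

Lemma even_nx s f i : even_pt (nx s f i) = even_pt f.
Proof.
by case: f => x y; rewrite /even_pt /nx; case: s; case: i => /=; lia.
Qed.

Lemma dual_edge_inj f g i k : even_pt f -> even_pt g ->
  dual_edge f i = dual_edge g k -> f = g /\ i = k.
Proof.
case: f g => [x y] [x' y']; rewrite /even_pt /=.
case: i; case: k => //= h1 h2 [] *; split=> //;
  try (congr pair; lia); exfalso; lia.
Qed.

Lemma hex_edgesE f : hex_edges f =
  [:: dual_edge f D0; dual_edge (nx false f D1) D1; dual_edge f D2;
      dual_edge (nx false f D0) D0; dual_edge f D1;
      dual_edge (nx false f D2) D2].
Proof.
case: f => x y; rewrite /hex_edges /dual_edge /nx /=.
by repeat (congr cons; try (congr pair; try (congr pair; lia))).
Qed.

Lemma mem_hex_edges f e :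
  (e \in hex_edges f) <->
  exists i, e = dual_edge f i \/ e = dual_edge (nx false f i) i.
Proof.
rewrite hex_edgesE !inE; split.
  by repeat case/orP; move=> /eqP ->; [exists D0 | exists D1 | exists D2 |
    exists D0 | exists D1 | exists D2]; auto.
by case=> -[] [] ->; rewrite eqxx ?orbT.
Qed.

Lemma corner_star f i k : even_pt f -> i != k ->
  perm_eq [:: dual_edge f i; dual_edge (nx true f i) k;
              dual_edge (nx false f (third i k)) (third i k)]
          (star (corner f i k)).
Proof.
move=> ef ik.
have r0 (p q r p' q' r' : edge) : p = p' -> q = q' -> r = r' ->
   perm_eq [:: p; q; r] [:: p'; q'; r'] by move=> -> -> ->.
have r1 (p q r p' q' r' : edge) : p = q' -> q = r' -> r = p' ->
   perm_eq [:: p; q; r] [:: p'; q'; r'].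
  by move=> -> -> ->; apply/permP => a /=; lia.
have r2 (p q r p' q' r' : edge) : p = r' -> q = p' -> r = q' ->
   perm_eq [:: p; q; r] [:: p'; q'; r'].
  by move=> -> -> ->; apply/permP => a /=; lia.
have pair_eq (a b a' b' : int) (t : bool) : a = a' -> b = b' ->
   ((a, b), t) = ((a', b'), t) by move=> -> ->.
case: f ef => x y; rewrite /even_pt /= => ef.
case: i k ik => -[] //= _; rewrite /star /corner /even_pt /=;
  case: ifP => h; (try by exfalso; lia); rewrite /dual_edge /nx /=;
  first [ by apply: r0; apply: pair_eq; lia
        | by apply: r1; apply: pair_eq; lia
        | by apply: r2; apply: pair_eq; lia ].
Qed.

Lemma uniq_star v : uniq (star v).
Proof.
case: v => x y; rewrite /star /= !inE !xpair_eqE /= !andbF !orbF /=.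
by rewrite andbT; apply/negP => /andP[/andP[/eqP h _] _]; lia.
Qed.

Lemma incident_star v f i : even_pt f ->
  incident v (dual_edge f i) = (dual_edge f i \in star v).
Proof.
case: v f => [a b] [x y]; rewrite /even_pt /incident /star /even_pt /= => ef.
by case: ifP => h; case: i; rewrite !inE /snd_end /= !xpair_eqE /=
  ?andbF ?andbT ?orbF ?orbA; apply/idP/idP; lia.
Qed.

Lemma incident_corner v f e : even_pt f -> e \in hex_edges f -> incident v e ->
  exists i k, i != k /\ v = corner f i k.
Proof.
case: v f => [a b] [x y] ef; rewrite /hex_edges !inE /=.
have mk i k (c d : int) : i != k -> corner (x, y) i k = (c, d) -> (a == c) && (b == d) ->
    exists i k, i != k /\ (a, b) = corner (x, y) i k.
  by move=> ik ek /andP[/eqP -> /eqP ->]; exists i, k.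
by repeat case/orP; move/eqP => ->; rewrite /incident /snd_end /= !xpair_eqE -?addrA;
  case/orP;
  first [ exact: (mk D0 D1) | exact: (mk D0 D2) | exact: (mk D1 D0)
        | exact: (mk D1 D2) | exact: (mk D2 D0) | exact: (mk D2 D1) ].
Qed.

(** * Potentials of chains *)

Definition edge_tail (e : edge) : pt :=
  (if e.2 then (e.1.1 - 2, e.1.2)
   else if even_pt e.1 then e.1 else (e.1.1, e.1.2 - 1))%R.
Definition edge_dir (e : edge) : dir :=
  if e.2 then D2 else if even_pt e.1 then D0 else D1.

(** The type [edge] also contains vertical pairs based at odd points, which are not edges of the
    lattice. *)
Definition lattice_edge (e : edge) : Prop :=
  exists f i, even_pt f /\ e = dual_edge f i.

Lemma edge_tailK f i : even_pt f ->
  edge_tail (dual_edge f i) = f /\ edge_dir (dual_edge f i) = i.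
Proof.
case: f => x y; rewrite /even_pt /= => ef.
case: i; rewrite /edge_tail /edge_dir /even_pt /= ?ef //.
  by case: ifP => h; [exfalso; lia | split=> //; congr pair; lia].
by split=> //; congr pair; lia.
Qed.

Lemma star_face v : exists f i k,
  [/\ even_pt f, i != k & v = corner f i k].
Proof.
case: v => a b; case: (boolP (even_pt (a, b))) => ev.
  by exists (a, b), D0, D1.
exists (a, b - 1)%R, D1, D0; split=> //; last by congr pair; rewrite /=; lia.
by move: ev; rewrite /even_pt /=; lia.
Qed.

Lemma star_sum (phi : edge -> int) f i k : even_pt f -> i != k ->
  (\sum_(e <- star (corner f i k)) phi e =
   phi (dual_edge f i) + phi (dual_edge (nx true f i) k) +
   phi (dual_edge (nx false f (third i k)) (third i k)))%R.
Proof.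
move=> ef ik; rewrite -(perm_big _ (corner_star ef ik)) !big_cons big_nil.
by rewrite /= addr0 addrA.
Qed.

Lemma star_lattice v e : e \in star v -> lattice_edge e.
Proof.
have [f [i [k [ef ik ->]]]] := star_face v.
rewrite -(perm_mem (corner_star ef ik)) !inE => /or3P[] /eqP ->.
- by exists f, i.
- by exists (nx true f i), k; rewrite even_nx.
- by exists (nx false f (third i k)), (third i k); rewrite even_nx.
Qed.

Lemma lattice_incident v e : lattice_edge e -> incident v e = (e \in star v).
Proof. by case=> f [i [ef ->]]; exact: incident_star. Qed.

(* A chain is a formal combination of lattice edges; when no lattice vertex is
   in its boundary, summing along the horizontal rays to the left gives a
   potential on the hexagons. *)
Definition coef (L : seq (edge * int)) (e : edge) : int :=
  (\sum_(t <- L | t.1 == e) t.2)%R.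
Definition divergence (L : seq (edge * int)) (v : pt) : int :=
  (\sum_(t <- L | incident v t.1) t.2)%R.
Definition potential (L : seq (edge * int)) (f : pt) : int :=
  (- \sum_(t <- L | [&& t.1.2, t.1.1.2 == f.2 & t.1.1.1 <= f.1]) t.2)%R.

Lemma coef_star L v : (forall t, t \in L -> lattice_edge t.1) ->
  (\sum_(e <- star v) coef L e = divergence L v)%R.
Proof.
move=> HL; rewrite /coef /divergence.
under eq_bigr => e _ do rewrite big_mkcond /=.
rewrite exchange_big /= [RHS]big_mkcond; apply: eq_big_seq => t /HL le.
rewrite (lattice_incident v le) -big_mkcond /=.
case: ifP => h.
  rewrite (big_rem t.1) // eqxx big1_seq; first exact: addr0.
  by move=> e /andP[/eqP <-]; rewrite mem_rem_uniq ?uniq_star // inE eqxx.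
by rewrite big1_seq // => e /andP[/eqP <-]; rewrite h.
Qed.

Lemma coef_cat L K e : (coef (L ++ K) e = coef L e + coef K e)%R.
Proof. by rewrite /coef big_cat. Qed.
Lemma divergence_cat L K v :
  (divergence (L ++ K) v = divergence L v + divergence K v)%R.
Proof. by rewrite /divergence big_cat. Qed.

Lemma coef_const (E : {fset edge}) (a : int) e :
  (coef [seq (x, a) | x <- E] e = if e \in E then a else 0)%R.
Proof.
rewrite /coef big_map /=; case: ifP => h.
  rewrite (big_rem e) // eqxx big1_seq; first exact: addr0.
  by move=> x /andP[/eqP ->]; rewrite mem_rem_uniq ?fset_uniq // inE eqxx.
rewrite big1_seq // => x /andP[/eqP -> xE].
by rewrite -[e \in E]/(e \in (enum_fset E)) xE in h.
Qed.

Lemma left_bound (L : seq (edge * int)) :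
  exists N : int, forall t, t \in L -> (N <= t.1.1.1)%R.
Proof.
elim: L => [|a l [B HB]]; first by exists 0%R.
exists (Num.min B a.1.1.1) => y; rewrite inE ge_min => /orP[/eqP->|/HB->//].
by rewrite lexx orbT.
Qed.

Lemma potential_left L N f : (forall t, t \in L -> N <= t.1.1.1)%R ->
  (f.1 < N)%R -> potential L f = 0%R.
Proof.
move=> HN fN; rewrite /potential big1_seq ?oppr0 // => t /andP[/and3P[_ _ h] /HN hN].
by have := le_lt_trans (le_trans hN h) fN; rewrite ltxx.
Qed.

Lemma left_induction (P : pt -> Prop) (N : int) :
  (forall f, (f.1 < N)%R -> P f) ->
  (forall f, P (nx false f D2) -> P f) -> forall f, P f.
Proof.
move=> h0 hS f; have [n] : exists n : nat, (f.1 < N + n%:Z + n%:Z)%R.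
  by case: f => x y /=; exists `|(x - N)%R|%N.+1; lia.
elim: n f => [|n IH] [x y] /= hf; first by apply: h0 => /=; lia.
by apply: hS; apply: IH; rewrite /=; lia.
Qed.

(** Let [B] be the defect of the identity. It vanishes across vertical edges by telescoping along a
    row, and zero divergence makes it sum to zero around each vertex. Hence its value in direction
    [D0] equals the one at the hexagon to the left, and it is zero far to the left. *)
Lemma potential_coef L f i : (forall t, t \in L -> lattice_edge t.1) ->
  (forall v, divergence L v = 0%R) -> even_pt f ->
  (potential L f - potential L (nx true f i) = coef L (dual_edge f i))%R.
Proof.
move=> HL HD ef; pose B g k := (potential L g - potential L (nx true g k)
  - coef L (dual_edge g k))%R.
suff : B f i = 0%R by rewrite /B => /eqP; rewrite subr_eq0 => /eqP.
have tri g j k : even_pt g -> j != k ->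
    (B g j + B (nx true g j) k + B (nx false g (third j k)) (third j k) = 0)%R.
  move=> eg jk; have := star_sum (coef L) eg jk.
  rewrite coef_star // HD /B (nx_nx true g jk) (nxKn true).
  move: (coef L _) (coef L _) (coef L _) => a b c.
  move: (potential L _) (potential L _) (potential L _) => a' b' c'; clear; lia.
have B2 g : even_pt g -> B g D2 = 0%R.
  move=> eg; rewrite /B /potential /coef opprK.
  apply/eqP; rewrite subr_eq0 addrC; apply/eqP.
  rewrite [X in (X - _)%R]big_mkcond [X in (_ - X)%R]big_mkcond [RHS]big_mkcond.
  rewrite -sumrB; apply: eq_big_seq => t /HL [g' [k [eg' ->]]].
  move: eg eg'; case: g g' => [x y] [x' y']; rewrite /even_pt /= => e1 e2.
  case: k; rewrite /= ?subrr //; rewrite ?xpair_eqE ?andbF //= ?andbT.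
  rewrite subr0; case: (eqVneq y' y) => [e|_]; last by rewrite /= andbF subrr.
  subst y'; rewrite /= andbT; move: (t.2) => z.
  have -> : (x - - (1 + 1) = x + 2)%R by lia.
  rewrite lerD2r (inj_eq (addIr _)); case: (eqVneq x' x) => [->|ne].
    by rewrite lexx; case: ifP; clear; lia.
  by have -> : (x' + 2 <= x)%R = (x' <= x)%R; [lia | rewrite subrr].
have B01 g : even_pt g -> B g D0 = (- B (nx true g D0) D1)%R.
  move=> eg; have := tri g D0 D1 eg isT.
  by rewrite B2 ?even_nx //; move: (B _ _) (B _ _) => a b; clear; lia.
have B10 g : even_pt g -> B g D1 = (- B (nx true g D1) D0)%R.
  move=> eg; have := tri g D1 D0 eg isT.
  by rewrite B2 ?even_nx //; move: (B _ _) (B _ _) => a b; clear; lia.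
have [N HN] := left_bound L.
have B0 g : even_pt g -> B g D0 = 0%R.
  apply: (@left_induction (fun g => even_pt g -> B g D0 = 0%R) N) => {}g.
    move=> gN _; rewrite /B (potential_left HN gN) (potential_left HN); last first.
      by case: g gN => x y /=; lia.
    rewrite /coef big1_seq ?subrr // => t /andP[/eqP et /HN].
    by rewrite et /= leNgt gN.
  move=> IH eg; rewrite B01 // B10 ?even_nx // opprK (nx_nx true g (i := D0)) //.
  by apply: IH; rewrite even_nx.
by case: i; [exact: B0 | rewrite B10 // B0 ?even_nx ?oppr0 | exact: B2].
Qed.

(** * The boundary cycle *)

Lemma lattice_horizontal p : lattice_edge (p, false).
Proof.
case: (boolP (even_pt p)) => ep; first by exists p, D0.
exists (p.1, p.2 - 1)%R, D1; split; last first.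
  by case: p ep => x y _; congr (pair (pair _ _)); rewrite /=; lia.
by case: p ep => x y; rewrite /even_pt /=; lia.
Qed.

Lemma lattice_vertical p : even_pt p -> lattice_edge (p, true).
Proof.
move=> ep; exists (p.1 - 2, p.2)%R, D2; split.
  by case: p ep => x y; rewrite /even_pt /=; lia.
by case: p ep => x y _; congr (pair (pair _ _)); rewrite /=; lia.
Qed.

Lemma adj_edge u v : adj u v ->
  [/\ lattice_edge (edge_of u v), u != v, even_pt v = ~~ even_pt u &
      forall w, incident w (edge_of u v) = (w == u) || (w == v)].
Proof.
case: u v => [x y] [x' y']; rewrite /adj /edge_of /even_pt !xpair_eqE /=.
have lr (a b a' b' : int) (t : bool) : (forall w,
    incident w ((a, b), t) = (w == (a, b)) || (w == (a', b'))) ->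
    (forall w, incident w ((a, b), t) = (w == (a', b')) || (w == (a, b))).
  by move=> h w; rewrite h orbC.
case/or4P.
- case/andP=> /eqP -> /eqP ->; rewrite eqxx.
  have -> : (x < x + 1)%R by lia.
  by split; [exact: lattice_horizontal | lia | lia |].
- case/andP=> /eqP -> /eqP ->; rewrite eqxx.
  have -> : (x' + 1 < x')%R = false by lia.
  split; [exact: lattice_horizontal | lia | lia |].
  exact: lr.
- case/and3P=> ev /eqP -> /eqP ->.
  have -> : (y == y + 1)%R = false by lia.
  have -> : (y < y + 1)%R by lia.
  by split; [exact: lattice_vertical | lia | lia |].
- case/and3P=> ev /eqP -> /eqP ->.
  have -> : (y' + 1 == y')%R = false by lia.
  have -> : (y' + 1 < y')%R = false by lia.
  split; [exact: lattice_vertical | lia | lia |].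
  exact: lr.
Qed.

Definition color (v : pt) : int := (if even_pt v then 1 else -1)%R.

Section Cycle.
Variable c : seq pt.
Hypothesis Hc : lattice_cycle c.

Definition cvert (j : nat) : pt := nth (0, 0)%R c j.
Definition cnext (j : nat) : nat := if j.+1 == size c then 0 else j.+1.
Definition cedge (j : nat) : edge := edge_of (cvert j) (cvert (cnext j)).

Lemma size_cycle : 3 <= size c. Proof. by case/and3P: Hc. Qed.
Lemma uniq_cycle : uniq c. Proof. by case/and3P: Hc. Qed.

Lemma cnext_lt j : j < size c -> cnext j < size c.
Proof. by rewrite /cnext; have := size_cycle; case: eqP; lia. Qed.

Lemma rot1_nth j : j < size c -> nth (0, 0)%R (rot 1 c) j = cvert (cnext j).
Proof.
have := size_cycle; rewrite /cvert /cnext; case: c => // x s _ jn.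
rewrite rot1_cons nth_rcons; move: jn => /=; rewrite ltnS leq_eqVlt eqSS.
by case: (eqVneq j (size s)) => [->|_ /= js]; [rewrite ltnn | rewrite js].
Qed.

Lemma cycle_edgesE : cycle_edges c = [seq cedge j | j <- iota 0 (size c)].
Proof.
apply: (@eq_from_nth _ ((0, 0), false)%R).
  by rewrite !size_map size_zip size_rot minnn size_iota.
move=> j; rewrite size_map size_zip size_rot minnn => jn.
rewrite (nth_map ((0, 0), (0, 0))%R) ?size_zip ?size_rot ?minnn //.
rewrite (nth_map 0) ?size_iota // nth_iota // add0n nth_zip ?size_rot //=.
by rewrite rot1_nth.
Qed.

Lemma cedge_in e : reflect (exists2 j, j < size c & e = cedge j) (e \in cycle_edges c).
Proof.
rewrite cycle_edgesE; apply: (iffP mapP) => -[j jn ->]; exists j => //.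
  by move: jn; rewrite mem_iota.
by rewrite mem_iota.
Qed.

Lemma cadj j : j < size c -> adj (cvert j) (cvert (cnext j)).
Proof.
move=> jn; rewrite -rot1_nth //; move: jn; rewrite /cvert.
case/and3P: Hc => _ _; case: c => // x s /=; rewrite rot1_cons.
move/(pathP (0, 0)%R) => h jn; have := h j; rewrite size_rcons => /(_ jn).
by rewrite -rcons_cons nth_rcons /= jn.
Qed.

Lemma cvert_inj i j : i < size c -> j < size c -> cvert i = cvert j -> i = j.
Proof.
by move=> ic jc /eqP; rewrite /cvert nth_uniq ?uniq_cycle // => /eqP.
Qed.

Lemma cedge_lattice j : j < size c -> lattice_edge (cedge j).
Proof. by move/cadj/adj_edge => []. Qed.

Lemma cedge_incident w j : j < size c ->
  incident w (cedge j) = (w == cvert j) || (w == cvert (cnext j)).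
Proof. by move/cadj/adj_edge => []. Qed.

Lemma color_next j : j < size c -> color (cvert (cnext j)) = (- color (cvert j))%R.
Proof.
by move/cadj/adj_edge => [_ _ h _]; rewrite /color h; case: even_pt.
Qed.

(** Length at least three matters: a closed walk of length two uses the same edge twice. *)
Lemma cedge_inj i j : i < size c -> j < size c -> cedge i = cedge j -> i = j.
Proof.
move=> ic jc e; have nic := cnext_lt ic; have njc := cnext_lt jc.
have h1 := cedge_incident (cvert i) jc; have h2 := cedge_incident (cvert (cnext i)) jc.
move: h1 h2; rewrite -e !cedge_incident // !eqxx orbT /=.
move=> /esym/orP[/eqP/cvert_inj->//|/eqP/cvert_inj h1].
move=> /esym/orP[/eqP/cvert_inj h2|/eqP/cvert_inj h2].
  have := h1 ic njc; have := h2 nic jc; have := size_cycle; rewrite /cnext.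
  by move: ic jc; clear; do 2 case: eqP; lia.
have := h2 nic njc; rewrite /cnext; move: ic jc; clear.
by do 2 case: eqP; lia.
Qed.

Lemma cvert_in v : reflect (exists2 j, j < size c & v = cvert j) (v \in c).
Proof.
apply: (iffP idP) => [vc|[j jn ->]]; last exact: mem_nth.
by exists (index v c); rewrite ?index_mem // /cvert nth_index.
Qed.

Lemma incident_cycle v e : e \in cycle_edges c -> incident v e -> v \in c.
Proof.
case/cedge_in=> j jn ->; rewrite cedge_incident // => /orP[] /eqP ->; apply/cvert_in.
  by exists j.
by exists (cnext j) => //; exact: cnext_lt.
Qed.

Lemma map_cvert : [seq cvert j | j <- iota 0 (size c)] = c.
Proof.
apply: (@eq_from_nth _ (0, 0)%R); rewrite size_map size_iota // => j jn.
by rewrite (nth_map 0) ?size_iota // nth_iota.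
Qed.

Lemma sum_cnext (g : pt -> int) :
  (\sum_(j <- iota 0 (size c)) g (cvert (cnext j)) =
   \sum_(j <- iota 0 (size c)) g (cvert j))%R.
Proof.
have e2 : [seq cvert (cnext j) | j <- iota 0 (size c)] = rot 1 c.
  apply: (@eq_from_nth _ (0, 0)%R); rewrite size_map size_iota ?size_rot // => j jn.
  by rewrite (nth_map 0) ?size_iota // nth_iota // rot1_nth.
rewrite -(big_map cvert xpredT g) -(big_map (fun j => cvert (cnext j)) xpredT g).
by rewrite map_cvert e2; apply: perm_big; rewrite perm_rot.
Qed.

(** Divergence ignores the direction of edges, so the coefficients must alternate along the cycle;
    the colour of the first vertex of each step provides this. *)
Definition cycle_chain : seq (edge * int) :=
  [seq (cedge j, color (cvert j)) | j <- iota 0 (size c)].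

Lemma cycle_chain_lattice t : t \in cycle_chain -> lattice_edge t.1.
Proof.
by case/mapP=> j; rewrite mem_iota => jn ->; exact: cedge_lattice.
Qed.

Lemma divergence_cedges (g : nat -> int) v :
  (divergence [seq (cedge j, g j) | j <- iota 0 (size c)] v =
   \sum_(j <- iota 0 (size c)) (if v == cvert j then g j else 0) +
   \sum_(j <- iota 0 (size c)) (if v == cvert (cnext j) then g j else 0))%R.
Proof.
rewrite /divergence big_map /= big_mkcond -big_split /=.
apply: eq_big_seq => j; rewrite mem_iota => /andP[_ jn].
rewrite cedge_incident //; case/cadj/adj_edge: jn => _ ne _ _.
case: (eqVneq v (cvert j)) => [->|_] /=; first by rewrite (negPf ne) addr0.
by case: ifP; rewrite add0r.
Qed.

Lemma divergence_cycle_chain v : divergence cycle_chain v = 0%R.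
Proof.
rewrite divergence_cedges.
rewrite -[X in (X + _)%R](sum_cnext (fun w => if v == w then color w else 0%R)).
rewrite -big_split big1_seq //= => j; rewrite mem_iota => jn.
by rewrite color_next //; case: ifP; rewrite ?addNr ?addr0.
Qed.

Lemma coef_cedges (g : nat -> int) i : i < size c ->
  coef [seq (cedge j, g j) | j <- iota 0 (size c)] (cedge i) = g i.
Proof.
move=> ic; rewrite /coef big_map /= (big_rem i) ?mem_iota //= eqxx big1_seq ?addr0 //.
move=> j /andP[/eqP e]; rewrite mem_rem_uniq ?iota_uniq // inE mem_iota => /andP[ne jn].
by move/eqP: ne; case; apply: cedge_inj e.
Qed.

Lemma coef_off_cycle (g : nat -> int) e : e \notin cycle_edges c ->
  coef [seq (cedge j, g j) | j <- iota 0 (size c)] e = 0%R.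
Proof.
move=> ec; rewrite /coef big_map /= big1_seq // => j /andP[/eqP e1].
by rewrite mem_iota => jn; case/negP: ec; apply/cedge_in; exists j.
Qed.

Definition winding (f : pt) : int := potential cycle_chain f.

Lemma winding_coef f i : even_pt f ->
  (winding f - winding (nx true f i) = coef cycle_chain (dual_edge f i))%R.
Proof.
exact: (potential_coef _ cycle_chain_lattice divergence_cycle_chain).
Qed.

(** Both sides sum over the same ray, and modulo 2 the signs of the coefficients disappear. *)
Lemma winding_interior f : even_pt f ->
  interior_hex c f = ~~ (2 %| winding f)%Z.
Proof.
move=> ef; rewrite /interior_hex ef /winding /potential /cycle_chain big_map /=.
rewrite cycle_edgesE count_map /preim.
elim: (iota 0 _) => [|j s IH] /=; first by rewrite big_nil.
rewrite big_cons oddD IH; case: ifP => _ //=; rewrite /color.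
by move: (bigop.body _ _ _); case: even_pt; lia.
Qed.

Lemma interior_across f i : even_pt f ->
  (interior_hex c f != interior_hex c (nx true f i)) =
  (dual_edge f i \in cycle_edges c).
Proof.
move=> ef; rewrite !winding_interior ?even_nx //.
have := winding_coef i ef.
case: (boolP (dual_edge f i \in cycle_edges c)) => [/cedge_in[j jn ->]|h].
  rewrite coef_cedges // => hw.
  have -> : (2 %| winding f)%Z = ~~ (2 %| winding (nx true f i))%Z.
    by move: hw; rewrite /color; case: even_pt; clear; lia.
  by case: (2 %| _)%Z.
by rewrite coef_off_cycle // => /eqP; rewrite subr_eq0 => /eqP ->; rewrite eqxx.
Qed.

(* Along the cycle the differences of [rho] alternate, because around each of
   its vertices they sum to zero. *)
Lemma cycle_supported (rho : pt -> int) (N : int) :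
  (forall f i, even_pt f -> dual_edge f i \notin cycle_edges c ->
     rho f = rho (nx true f i)) ->
  (forall f, (f.1 < N)%R -> rho f = 0%R) ->
  exists a : int, forall f, even_pt f -> (rho f = a * winding f)%R.
Proof.
move=> hoff hleft.
pose phi e := (rho (edge_tail e) - rho (nx true (edge_tail e) (edge_dir e)))%R.
have phiE f i : even_pt f -> phi (dual_edge f i) = (rho f - rho (nx true f i))%R.
  by move=> ef; rewrite /phi; have [-> ->] := edge_tailK i ef.
have phi_off e : lattice_edge e -> e \notin cycle_edges c -> phi e = 0%R.
  by case=> f [i [ef ->]] h; rewrite phiE // (hoff f i ef h) subrr.
have phi_star v : (\sum_(e <- star v) phi e = 0)%R.
  have [f [i [k [ef ik ->]]]] := star_face v.
  rewrite star_sum // !phiE ?even_nx // (nxKn true).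
  have -> : nx true (nx true f i) k = nx false f (third i k) := nx_nx true f ik.
  by move: (rho _) (rho _) (rho _) => p q r; clear; lia.
pose a := (color (cvert 0) * phi (cedge 0))%R.
have sz := size_cycle.
have const j : j < size c -> (color (cvert j) * phi (cedge j) = a)%R.
  elim: j => [//|j IH] jn; have jn' : j < size c by exact: ltnW.
  have nj : cnext j = j.+1 by rewrite /cnext; case: eqP jn; lia.
  rewrite -IH // -nj color_next // nj.
  have e1 : incident (cvert j.+1) (cedge j) by rewrite cedge_incident // nj eqxx orbT.
  have e2 : incident (cvert j.+1) (cedge j.+1) by rewrite cedge_incident // eqxx.
  have := phi_star (cvert j.+1).
  rewrite lattice_incident in e1; last exact: cedge_lattice.
  rewrite lattice_incident in e2; last exact: cedge_lattice.
  have ne : cedge j.+1 != cedge j.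
    by apply/eqP => /(cedge_inj jn jn'); lia.
  have [r hr] : exists r, perm_eq (star (cvert j.+1)) [:: cedge j, cedge j.+1 & r].
    exists (rem (cedge j.+1) (rem (cedge j) (star (cvert j.+1)))).
    apply: perm_trans (perm_to_rem e1) _; rewrite perm_cons; apply: perm_to_rem.
    by rewrite mem_rem_uniq ?uniq_star // inE ne.
  have ur := uniq_star (cvert j.+1); rewrite (perm_uniq hr) /= inE negb_or in ur.
  case/and3P: ur => /andP[_ nj1] nj2 _.
  rewrite (perm_big _ hr) !big_cons big1_seq => [/=|e /= er].
    by move: (phi _) (phi _) (color _) => p q s; rewrite addr0; clear; nia.
  have es : e \in star (cvert j.+1) by rewrite (perm_mem hr) !inE er !orbT.
  have n1 : e != cedge j.+1 by apply: contraNneq nj2 => <-.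
  have n2 : e != cedge j by apply: contraNneq nj1 => <-.
  apply: phi_off; first exact: star_lattice es.
  apply/negP => /cedge_in[q qn eq]; move: es.
  rewrite -lattice_incident; last by rewrite eq; exact: cedge_lattice.
  rewrite eq cedge_incident // => /orP[/eqP/cvert_inj h|/eqP/cvert_inj h].
    by move: n1; rewrite eq -h // eqxx.
  have qj : q = j.
    have := h jn (cnext_lt qn); move: (qn) (jn); rewrite /cnext.
    by clear; case: eqP; lia.
  by move: n2; rewrite eq qj eqxx.
exists a.
(* The difference does not change across any edge and is zero far to the left, so it vanishes. *)
pose delta f := (rho f - a * winding f)%R.
have dflat f i : even_pt f -> delta f = delta (nx true f i).
  move=> ef; have := winding_coef i ef; rewrite /delta.
  case: (boolP (dual_edge f i \in cycle_edges c)) => h; last first.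
    rewrite coef_off_cycle // (hoff _ _ ef h) => /eqP.
    by rewrite subr_eq0 => /eqP ->.
  case/cedge_in: h => j jn ej; rewrite ej coef_cedges // => hw.
  have := const j jn; rewrite -ej phiE // => <-.
  have := hw; rewrite /color; case: even_pt => {}hw;
    have -> : winding f = (winding (nx true f i) + (winding f - winding (nx true f i)))%R
      by [clear; lia | rewrite addrC subrK];
  rewrite hw; clear; lia.
have [B HB] := left_bound cycle_chain.
suff : forall f, even_pt f -> delta f = 0%R.
  by move=> h f /h /eqP; rewrite /delta subr_eq0 => /eqP.
apply: (@left_induction (fun f => even_pt f -> delta f = 0%R) (Num.min N B)) => f.
  rewrite lt_min => /andP[fN fB] _; rewrite /delta hleft //.
  by rewrite /winding (potential_left HB fB) mulr0 subrr.
move=> IH ef; rewrite -(nxKn true f D2) -dflat ?IH ?even_nx //.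
Qed.

(* A discrete Jordan curve theorem: the exterior hexagons are connected. *)
Lemma zero_outside (rho : pt -> int) (N : int) :
  (forall f i, even_pt f -> ~~ interior_hex c f -> ~~ interior_hex c (nx true f i) ->
     rho f = rho (nx true f i)) ->
  (forall f, (f.1 < N)%R -> rho f = 0%R) ->
  forall f, even_pt f -> ~~ interior_hex c f -> rho f = 0%R.
Proof.
move=> hout hleft f ef fI.
(* Both [out] and the indicator of the interior change only across edges of the cycle, so both are
   multiples of the winding. The indicator is a nonzero multiple, hence the winding, and with it
   [out], vanishes at every exterior hexagon. *)
pose out g := (if interior_hex c g then 0 else rho g)%R.
have [B HB] := left_bound cycle_chain.
have left_out g : even_pt g -> (g.1 < B)%R -> interior_hex c g = false.
  by move=> eg gB; rewrite winding_interior // /winding (potential_left HB gB).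
have same g i : even_pt g -> dual_edge g i \notin cycle_edges c ->
    interior_hex c g = interior_hex c (nx true g i).
  by move=> eg; rewrite -interior_across // negbK => /eqP.
have [a ha] : exists a : int, forall g, even_pt g -> (out g = a * winding g)%R.
  apply: (@cycle_supported out N) => [g i eg off|g gN].
    rewrite /out -same //; case: ifP => // gI; apply: hout => //.
      by rewrite gI.
    by rewrite -same // gI.
  by rewrite /out; case: ifP => // _; exact: hleft.
have [b hb] : exists b : int, forall g, even_pt g ->
    ((interior_hex c g)%:Z = b * winding g)%R.
  apply: (@cycle_supported (fun g => (interior_hex c g)%:Z)%R B) => [g i eg off|g gB].
    by rewrite -same.
  case: (boolP (even_pt g)) => eg; first by rewrite left_out.
  by rewrite /interior_hex (negPf eg).
have b0 : b != 0%R.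
  have c0 : 0 < size c by have := size_cycle; lia.
  have [g [i [eg ei]]] := cedge_lattice c0.
  have : dual_edge g i \in cycle_edges c by rewrite -ei; apply/cedge_in; exists 0.
  rewrite -interior_across //; apply: contraNneq => b0.
  have := hb g eg; have := hb (nx true g i); rewrite even_nx => /(_ eg).
  by rewrite b0 !mul0r; do 2 case: interior_hex.
have := hb f ef; rewrite (negPf fI) => /esym/eqP; rewrite mulf_eq0 (negPf b0) /=.
by move=> /eqP w0; have := ha f ef; rewrite /out (negPf fI) w0 mulr0.
Qed.

End Cycle.

(** * Perfect matchings of the system *)

(** The matching bounds the interior: the lower-left corner of an interior hexagon must be an end of
    one of the finitely many edges of [M]. *)
Lemma interior_finite c M : perfect_matching c M ->
  exists I : {fset pt}, forall f, (f \in I) = interior_hex c f.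
Proof.
move=> [_ hV].
exists [fset f in [seq e.1 | e <- M] ++ [seq snd_end e | e <- M] | interior_hex c f].
move=> f; rewrite !inE; case: (boolP (interior_hex c f)) => fI; last by rewrite andbF.
have : vH c f.
  exists (f, false); split; last by rewrite /incident eqxx.
  exists f; split=> //; apply/mem_hex_edges; exists D0; left.
  by [].
case/hV=> e [[eM inc] _]; rewrite andbT mem_cat.
by case/orP: inc => /eqP ->; rewrite map_f ?orbT.
Qed.

Section System.
Variable c : seq pt.
Variable I : {fset pt}.
Hypothesis HI : forall f, (f \in I) = interior_hex c f.

Lemma even_interior f : f \in I -> even_pt f.
Proof. by rewrite HI => /andP[]. Qed.

Lemma even_arc f i : (f \in I) || (nx true f i \in I) -> even_pt f.
Proof. by case/orP=> /even_interior //; rewrite even_nx. Qed.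

Lemma inH_dual f i : even_pt f ->
  inH c (dual_edge f i) <-> (f \in I) || (nx true f i \in I).
Proof.
move=> ef; split.
  case=> h [hI /mem_hex_edges[k eh]]; rewrite -HI in hI.
  have eh' := even_interior hI.
  case: eh => /dual_edge_inj[] //; rewrite ?even_nx // => -> ->.
    by rewrite hI.
  by rewrite (nxKn true) hI orbT.
case/orP=> h; rewrite HI in h.
  by exists f; split=> //; apply/mem_hex_edges; exists i; left.
exists (nx true f i); split=> //; apply/mem_hex_edges; exists i; right.
by rewrite (nxK true).
Qed.

Lemma inH_lattice e : inH c e -> lattice_edge e.
Proof.
case=> h [hI /mem_hex_edges[k eh]]; rewrite -HI in hI.
have eh' := even_interior hI.
by case: eh => ->; [exists h, k | exists (nx false h k), k; rewrite even_nx].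
Qed.

Lemma vH_corner v : vH c v <-> exists f i k, [/\ f \in I, i != k & v = corner f i k].
Proof.
split=> [[e [[f [fI ef]] inc]]|[f [i [k [fI ik ->]]]]].
  rewrite -HI in fI; have [i [k [ik ->]]] := incident_corner (even_interior fI) ef inc.
  by exists f, i, k.
have ef := even_interior fI; exists (dual_edge f i); split.
  by apply/inH_dual; rewrite ?fI.
by rewrite incident_star // -(perm_mem (corner_star ef ik)) !inE eqxx.
Qed.

Definition edge_matching (M : {fset edge}) (f : pt) (i : dir) : bool :=
  even_pt f && (dual_edge f i \in M).

Lemma edge_matchingE M f i : even_pt f -> edge_matching M f i = (dual_edge f i \in M).
Proof. by rewrite /edge_matching => ->. Qed.

Lemma star_count M v : perfect_matching c M -> vH c v ->
  count (mem M) (star v) = 1.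
Proof.
move=> [hE hV] /hV[e [[eM inc] uniq_e]].
have es : e \in star v by rewrite -lattice_incident //; exact/inH_lattice/hE.
rewrite (eq_in_count (a2 := pred1 e)); first by rewrite count_uniq_mem ?uniq_star ?es.
move=> x xs /=; apply/idP/eqP => [xM|-> //].
by apply/esym/uniq_e; rewrite lattice_incident //; exact/inH_lattice/hE.
Qed.

Lemma star_count0 M v : perfect_matching c M -> ~ vH c v ->
  count (mem M) (star v) = 0.
Proof.
move=> [hE _] nv; apply/eqP; rewrite -leqn0 leqNgt -has_count; apply/negP.
case/hasP=> e es /= /hE eH; apply: nv; exists e; split=> //.
by rewrite lattice_incident //; exact: inH_lattice.
Qed.

Lemma pm_matching M : perfect_matching c M -> matching true I (edge_matching M).
Proof.
move=> pM; split=> [f i /andP[ef eM]|f i k fI ik].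
  by apply/inH_dual => //; exact: (proj1 pM).
have ef := even_interior fI.
have : count (mem M) (star (corner f i k)) = 1.
  by apply: star_count => //; apply/vH_corner; exists f, i, k.
have /permP <- := corner_star ef ik.
by rewrite /= !edge_matchingE ?even_nx // addn0 addnA.
Qed.

Lemma matching_pm m : matching true I m -> exists M,
  perfect_matching c M /\ forall f i, edge_matching M f i = m f i.
Proof.
move=> Hm; pose D := [seq e <- all_arcs true I | m e.1 e.2].
have evm f i : m f i -> even_pt f.
  by case: Hm => h _ /h; exact: even_arc.
have memD f i : ((f, i) \in D) = m f i.
  rewrite mem_filter /=; case mf: (m f i) => //=.
  by rewrite mem_all_arcs; case: Hm => /(_ f i mf).
pose M := [fset e in [seq dual_edge e.1 e.2 | e <- D]].
have memM f i : even_pt f -> (dual_edge f i \in M) = m f i.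
  move=> ef; rewrite inE; apply/mapP/idP => [[[g k] /= gD e]|mf].
    have eg : even_pt g by move: gD; rewrite memD => /evm.
    by have [-> ->] := dual_edge_inj ef eg e; rewrite -memD.
  by exists (f, i); rewrite ?memD.
have latM e : e \in M -> lattice_edge e.
  rewrite inE => /mapP[[g k] gD ->]; exists g, k; split=> //.
  by move: gD; rewrite memD => /evm.
exists M; split; last first.
  move=> f i; rewrite /edge_matching; case: (boolP (even_pt f)) => [/memM->//|ef].
  by case mf: (m f i) => //=; move: (evm f i mf); rewrite (negPf ef).
split=> [e eM|v /vH_corner[f [i [k [fI ik ->]]]]].
  have [f [i [ef ee]]] := latM e eM; rewrite ee in eM *; apply/inH_dual => //.
  by apply: (proj1 Hm); rewrite -memM.
have ef := even_interior fI.
have : count (mem M) (star (corner f i k)) = 1.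
  have /permP <- := corner_star ef ik.
  by rewrite /= !memM ?even_nx // addn0 addnA (proj2 Hm).
move=> cnt; have : has (mem M) (star (corner f i k)) by rewrite has_count cnt.
case/hasP=> e es eM; exists e; split.
  by split=> //; rewrite lattice_incident //; exact: latM.
move=> x [xM xinc]; have xs : x \in star (corner f i k).
  by rewrite -lattice_incident //; exact: latM.
apply/eqP; apply/negPn/negP => ne; move: cnt.
have hr := perm_to_rem es; have /permP -> := hr.
have xr : x \in rem e (star (corner f i k)).
  by rewrite mem_rem_uniq ?uniq_star // inE xs eq_sym ne.
have /permP := perm_to_rem xr => hr'; rewrite [count _ _]/= hr' /=.
by move: eM xM => /= -> ->.
Qed.

(** * Anti-forcing sets as transversals of the directed cuts *)

Lemma cut_crossed m W : matching true I m -> cut true I m W ->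
  exists2 e, e \in free_arcs true I m & cross true e W.
Proof.
move=> Hm /cutP[W0 /fsubsetP WI _].
(* For a leftmost hexagon, the neighbours to the left and to the lower left are outside the cut; the
   two sides towards them are consecutive, so one of them is unmatched. *)
have [f [fW fmin]] := fset_argmin (fun g : pt => g.1) W0.
have nl : nx false f D2 \notin W.2.
  by apply/negP => /fmin; case: f {fW fmin} => x y /=; lia.
have nd : nx true f D0 \notin W.2.
  by apply/negP => /fmin; case: f {fW fmin nl} => x y /=; lia.
have fI := WI f fW; have := in_arc_excl Hm fI (erefl : D0 != D2).
case: (boolP (m f D0)) => mf h.
  exists (nx false f D2, D2);
    rewrite ?mem_free_arcs /crosses /hd /= (nxKn true) ?fI ?orbT.
    by move: h; case: (m _ D2).
  by rewrite fW (negPf nl).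
exists (f, D0); first by rewrite mem_free_arcs mf fI.
by rewrite /crosses /hd /= fW (negPf nd).
Qed.

(** Flipping [M] along a packed cut gives another perfect matching, so the cut must cross an edge of
    [S]; capacity one prevents two cuts from sharing that edge. *)
Lemma pack_le_anti_forcing M F S : perfect_matching c M ->
  pack true I (edge_matching M) F -> anti_forcing c M S -> size F <= #|` S|.
Proof.
move=> pM pF [hS hU]; have Hm := pm_matching pM.
have arcS e : e \in S -> exists f i,
    [/\ even_pt f, e = dual_edge f i, (edge_tail e, edge_dir e) = (f, i) &
        edge_matching M f i = false].
  move=> eS; have [eH eM] := hS e eS; have [f [i [ef ee]]] := inH_lattice eH.
  exists f, i; split=> //; first by rewrite ee; have [-> ->] := edge_tailK i ef.
  by rewrite edge_matchingE // -ee (negPf eM).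
have hit W : W \in F -> exists2 e, e \in S & cross true (edge_tail e, edge_dir e) W.
  move=> WF; have cW : cut true I (edge_matching M) W.
    by case/packP: pF => hc _; exact: hc.
  apply: NNPP => no; have [M' [pM' mM']] := matching_pm (matching_flip Hm cW).
  have eqM : M' = M.
    apply: hU; case: (pM') => h1 h2; split=> // e eM'; split; first exact: h1.
    apply/negP => eS; have [f [i [ef ee ea nm]]] := arcS e eS.
    have := mM' f i; rewrite /flip nm addFb edge_matchingE // -ee eM' => cr.
    by apply: no; exists e; rewrite ?ea.
  have [[f i] _ cr] := cut_crossed Hm cW.
  by have := mM' f i; rewrite eqM /flip cr addbT; case: edge_matching.
apply: (@leq_trans (\sum_(e <- S) ld true F (edge_tail e, edge_dir e))).
  rewrite /load exchange_big /= -sum1_size big_seq [X in _ <= X]big_seq.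
  apply: leq_sum => W WF; have [e eS cW] := hit W WF.
  by rewrite (big_rem e) //= cW.
rewrite -[#|` S|]/(size (enum_fset S)) -sum1_size big_seq [X in _ <= X]big_seq.
apply: leq_sum => e eS; have [f [i [ef ee -> nm]]] := arcS e eS.
by case/packP: pF => _; apply; rewrite nm.
Qed.

Lemma sum_indicator (M : {fset edge}) (a : int) v :
  (\sum_(e <- star v) (if e \in M then a else 0) = a *+ count (mem M) (star v))%R.
Proof. by rewrite -big_mkcond /= big_const_seq iter_addr_0. Qed.

Hypothesis Hc : lattice_cycle c.

(** For a perfect matching [M'] avoiding [S], the chain [M' - M] has a potential that vanishes
    outside. It never increases along free arcs, so its positive and negative sets are directed cuts
    if nonempty; but it is constant across the arcs of [S], which would have to meet them. *)
Lemma hitting_anti_forcing M (S : {fset pt * dir}) : perfect_matching c M ->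
  S `<=` free_arcs true I (edge_matching M) ->
  (forall W, cut true I (edge_matching M) W -> exists2 e, e \in S & cross true e W) ->
  anti_forcing c M [fset e in [seq dual_edge e.1 e.2 | e <- S]].
Proof.
move=> pM /fsubsetP SF hit; have Hm := pm_matching pM.
have freeP f i : (f, i) \in S ->
    [/\ even_pt f, dual_edge f i \notin M & inH c (dual_edge f i)].
  move/SF; rewrite mem_free_arcs => /andP[nm fI]; have ef := even_arc fI.
  by rewrite edge_matchingE // in nm; split=> //; apply/inH_dual.
split=> [e|M' [hE hV]].
  by rewrite inE => /mapP[[f i] /freeP[_ h1 h2] ->].
have pM' : perfect_matching c M' by split=> // e /hE[].
have avoid f i : (f, i) \in S -> dual_edge f i \notin M'.
  move=> fS; apply/negP => /hE[_]; rewrite inE => /negP; apply.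
  by apply/mapP; exists (f, i).
pose L := [seq (x, 1%R : int) | x <- M'] ++ [seq (x, (- 1)%R : int) | x <- M].
have HL t : t \in L -> lattice_edge t.1.
  rewrite mem_cat => /orP[] /mapP[x xM ->]; apply: inH_lattice.
    exact: (proj1 pM').
  exact: (proj1 pM).
have cL e : (coef L e = (e \in M')%:Z - (e \in M)%:Z)%R.
  by rewrite coef_cat !coef_const; case: (e \in M'); case: (e \in M).
have DL v : divergence L v = 0%R.
  rewrite -coef_star //; under eq_bigr => e _ do rewrite coef_cat !coef_const.
  rewrite big_split /= !sum_indicator; case: (classic (vH c v)) => hv.
    by rewrite !star_count.
  by rewrite !star_count0.
pose rho := potential L.
have hrho f i : even_pt f -> (rho f - rho (nx true f i) =
    (dual_edge f i \in M')%:Z - (dual_edge f i \in M)%:Z)%R.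
  by move=> ef; rewrite -cL; exact: potential_coef.
have [N HN] := left_bound L.
have out f : even_pt f -> f \notin I -> rho f = 0%R.
  rewrite HI; apply: (@zero_outside c Hc rho N) => [g i eg g1 g2|g gN]; last first.
    exact: potential_left gN.
  have nH : ~ inH c (dual_edge g i).
    by move/(inH_dual i eg); rewrite !HI (negPf g1) (negPf g2).
  have := hrho g i eg.
  have -> : (dual_edge g i \in M') = false by apply/negP => /(proj1 pM').
  have -> : (dual_edge g i \in M) = false by apply/negP => /(proj1 pM).
  by rewrite subrr => /eqP; rewrite subr_eq0 => /eqP.
have step f i : even_pt f -> ~~ edge_matching M f i ->
    (rho f - rho (nx true f i) = (dual_edge f i \in M')%:Z)%R.
  by move=> ef; rewrite edge_matchingE // hrho // => /negPf ->; rewrite subr0.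
have level b (P : pred int) : ~~ P 0%R ->
    (forall x y : int, (y <= x)%R -> if b then P y -> P x else P x -> P y) ->
    forall f, f \in I -> ~~ P (rho f).
  move=> P0 mono f fI; apply/negP => Pf.
  pose W := (b, [fset g in I | P (rho g)]).
  have memW g : even_pt g -> (g \in W.2) = P (rho g).
    move=> eg; rewrite !inE /=; case: (boolP (g \in I)) => //= gI.
    by rewrite out // (negPf P0).
  have /hit[[g i] gS] : cut true I (edge_matching M) W.
    apply/cutP; split=> /=.
    - by apply/fset0Pn; exists f; rewrite !inE fI.
    - by apply/fsubsetP => g; rewrite !inE => /andP[].
    - move=> g i nm; have key : (g \in I) || (nx true g i \in I) ->
          if b then nx true g i \in W.2 -> g \in W.2
          else g \in W.2 -> nx true g i \in W.2.
        move=> /even_arc eg; rewrite !memW ?even_nx //.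
        have := step g i eg nm => hst.
        have := mono (rho g) (rho (nx true g i)); apply.
        by rewrite -subr_ge0 hst.
      move: key; case: (boolP (g \in I)) => gI /=; first exact.
      case: (boolP (nx true g i \in I)) => nI /=; first exact.
      by case: b {W memW mono} => _; rewrite !inE ?(negPf gI) ?(negPf nI).
  have [eg h1 h2] := freeP g i gS; rewrite /crosses /hd /= !memW ?even_nx //.
  have := step g i eg; rewrite edge_matchingE // h1 (negPf (avoid g i gS)).
  by move=> /(_ isT)/eqP; rewrite subr_eq0 => /eqP ->; rewrite eqxx.
have rho0 f : even_pt f -> rho f = 0%R.
  move=> ef; case: (boolP (f \in I)) => fI; last exact: out.
  have h1 := @level true (fun x => 0 < x)%R isT
    (fun x y h h' => lt_le_trans h' h) f fI.
  have h2 := @level false (fun x => x < 0)%R isT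
    (fun x y h h' => le_lt_trans h h') f fI.
  by move: h1 h2; rewrite -!leNgt => h1 h2; apply/eqP; rewrite eq_le h1 h2.
have eqd f i : even_pt f -> (dual_edge f i \in M') = (dual_edge f i \in M).
  move=> ef; have := hrho f i ef; rewrite !rho0 ?even_nx // subrr.
  by case: (_ \in M'); case: (_ \in M).
apply/fsetP => e; apply/idP/idP => h.
  by have [f [i [ef ee]]] := inH_lattice (proj1 pM' e h); rewrite ee -eqd // -ee.
by have [f [i [ef ee]]] := inH_lattice (proj1 pM e h); rewrite ee eqd // -ee.
Qed.

(** * Existence of the height *)

Lemma snd_end_color e : (color (snd_end e) = - color e.1)%R.
Proof.
by case: e => -[x y] [] /=; rewrite /color /even_pt /snd_end /=;
  case: ifP => h1; case: ifP => h2 //; exfalso; lia.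
Qed.

Lemma snd_end_neq e : (snd_end e == e.1) = false.
Proof.
by apply/negP => /eqP; case: e => -[x y] [] /=; rewrite /snd_end /= => -[]; lia.
Qed.

Lemma sum_pred1 (T : eqType) (r : seq T) (F : T -> int) a : uniq r -> a \in r ->
  (\sum_(v <- r | v == a) F v = F a)%R.
Proof. by move=> ur ar; rewrite -big_filter filter_pred1_uniq // big_seq1. Qed.

Lemma sum_two (r : seq pt) (F : pt -> int) a b : uniq r -> a \in r -> b \in r ->
  a != b -> (\sum_(v <- r | (v == a) || (v == b)) F v = F a + F b)%R.
Proof.
move=> ur ar br ab.
have one x : x \in r -> (\sum_(v <- r) (if v == x then F v else 0) = F x)%R.
  by move=> xr; rewrite -big_mkcond sum_pred1.
rewrite -(one a) // -(one b) // -big_split big_mkcond /=; apply: eq_bigr => v _.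
case: (eqVneq v a) => [->|_] /=; last by case: ifP; rewrite add0r.
by rewrite (negPf ab) addr0.
Qed.

(** Every edge has ends of opposite colours, so its two contributions cancel. *)
Lemma colored_divergence (L : seq (edge * int)) :
  (forall v, v \notin c -> divergence L v = 0%R) ->
  (\sum_(v <- c) color v * divergence L v = 0)%R.
Proof.
move=> h0.
pose V := undup (c ++ [seq t.1.1 | t <- L] ++ [seq snd_end t.1 | t <- L]).
have uV : uniq V := undup_uniq _.
have -> : (\sum_(v <- c) color v * divergence L v =
           \sum_(v <- V) color v * divergence L v)%R.
  rewrite [RHS](bigID (mem c)) /= [X in (_ + X)%R]big1 ?addr0 => [|v vc]; last first.
    by rewrite h0 ?mulr0.
  rewrite -[RHS]big_filter; apply: perm_big; apply: uniq_perm.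
  - exact: uniq_cycle.
  - exact: filter_uniq.
  - by move=> v; rewrite mem_filter /= mem_undup mem_cat; case: (v \in c).
rewrite /divergence.
under eq_bigr => v _ do rewrite big_distrr /= big_mkcond /=.
rewrite exchange_big /= big1_seq // => t /= tL.
rewrite -big_mkcond /= /incident (sum_two _ uV) ?snd_end_color.
- by rewrite -mulrDl addrN mul0r.
- by rewrite mem_undup !mem_cat (map_f (fun t => t.1.1)) ?orbT.
- by rewrite mem_undup !mem_cat (map_f (fun t => snd_end t.1)) ?orbT.
- by rewrite eq_sym snd_end_neq.
Qed.

Lemma sum_cycle (G : pt -> int) :
  (\sum_(v <- c) G v = \sum_(j <- iota 0 (size c)) G (cvert c j))%R.
Proof. by rewrite -{1}(map_cvert c) big_map. Qed.

(** Multiplied by colours, the equations at consecutive vertices telescope: [kappa] is a signed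
    partial sum of [color v * g v], and it closes up around the cycle because the total is zero. *)
Lemma cycle_correction (g : pt -> int) :
  (forall v, v \notin c -> g v = 0%R) ->
  (\sum_(v <- c) color v * g v = 0)%R ->
  exists kappa : nat -> int, forall v,
    divergence [seq (cedge c j, kappa j) | j <- iota 0 (size c)] v = (- g v)%R.
Proof.
move=> g0 gsum; pose x (v : pt) := (color v * g v)%R.
pose S j := (\sum_(l <- iota 0 j.+1) x (cvert c l))%R.
pose kappa j := (- (color (cvert c j) * S j))%R.
have sz := size_cycle Hc.
have cc v : (color v * color v = 1)%R.
  by rewrite /color; case: even_pt.
have Sn j : j < size c -> (S j = S (cnext c j) - x (cvert c (cnext c j)))%R.
  move=> jc; rewrite /cnext; case: eqP => [ej|_].
    rewrite {2}/S /= big_cons big_nil addr0 subrr /S ej.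
    by rewrite -(sum_cycle x).
  by rewrite {2}/S -[j.+2]addn1 iotaD big_cat big_seq1 add0n addrK.
pose K w := kappa (index w c).
have KE j : j < size c -> kappa j = K (cvert c j).
  by move=> jc; rewrite /K /cvert index_uniq // uniq_cycle.
exists kappa => v; rewrite divergence_cedges //.
have -> : (\sum_(j <- iota 0 (size c)) (if v == cvert c (cnext c j) then kappa j else 0) =
  \sum_(j <- iota 0 (size c)) (if v == cvert c (cnext c j) then
     - K (cvert c (cnext c j)) - g (cvert c (cnext c j)) else 0))%R.
  apply: eq_big_seq => j; rewrite mem_iota => /andP[_ jc]; case: ifP => // _.
  have njc := cnext_lt Hc jc; rewrite -KE // /kappa Sn // color_next //.
  set w := cvert c (cnext c j); have := cc (cvert c j).
  have := color_next Hc jc; rewrite -/w => ew; have := cc w.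
  have -> : color (cvert c j) = (- color w)%R by rewrite ew opprK.
  rewrite /x; move: (S _) (g w) (color w) => p q r e _.
  by rewrite mulNr !opprK mulrBr mulrA e mul1r.
rewrite (sum_cnext Hc (fun w => if v == w then - K w - g w else 0)%R).
rewrite -big_split /=.
rewrite (eq_big_seq (fun j => if v == cvert c j then - g (cvert c j) else 0)%R).
  rewrite -(sum_cycle (fun w => if v == w then - g w else 0)%R) -big_mkcond /=.
  case: (boolP (v \in c)) => vc.
    rewrite (eq_bigl (pred1 v)) => [|w]; last by rewrite /= eq_sym.
    by rewrite sum_pred1 ?uniq_cycle.
  rewrite g0 // oppr0 big1_seq // => w /andP[/eqP <-]; by rewrite (negPf vc).
move=> j; rewrite mem_iota => /andP[_ jc]; case: ifP => [_|]; last by rewrite addr0.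
by rewrite KE // addrA addrN add0r.
Qed.

(* Each vertex of the system off the boundary cycle meets one matched and two
   unmatched edges, so [3 M - 1] has no boundary there and can be corrected
   along the cycle. *)
Lemma exists_height M : perfect_matching c M -> exists h : pt -> int,
  forall f i, f \in I -> nx true f i \in I ->
    (h (nx true f i) = h f + 1 - (edge_matching M f i)%:Z * 3)%R.
Proof.
move=> pM; pose E := [fset e in [seq dual_edge e.1 e.2 | e <- all_arcs true I]].
have memE f i : even_pt f ->
    (dual_edge f i \in E) = (f \in I) || (nx true f i \in I).
  move=> ef; rewrite inE; apply/mapP/idP => [[[g k] /= gD e]|fI].
    have eg : even_pt g by apply: (@even_arc g k); rewrite -mem_all_arcs.
    by have [-> ->] := dual_edge_inj ef eg e; rewrite -mem_all_arcs.
  by exists (f, i); rewrite ?mem_all_arcs.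
have EH e : e \in E -> inH c e.
  rewrite inE => /mapP[[g k] gD ->].
  rewrite mem_all_arcs in gD; apply/inH_dual => //; exact: even_arc gD.
pose L := [seq (x, 3%R : int) | x <- M] ++ [seq (x, (- 1)%R : int) | x <- E].
have HL t : t \in L -> lattice_edge t.1.
  rewrite mem_cat => /orP[] /mapP[y yM ->]; apply: inH_lattice.
    exact: (proj1 pM).
  exact: EH.
have L0 v : v \notin c -> divergence L v = 0%R.
  move=> vc; rewrite -coef_star //.
  under eq_bigr => e _ do rewrite coef_cat !coef_const.
  rewrite big_split /= !sum_indicator; case: (classic (vH c v)) => hv.
    rewrite star_count //; have [f [i [k [fI ik ev]]]] := proj1 (vH_corner v) hv.
    subst v.
    have ef := even_interior fI.
    have off e : e \in star (corner f i k) -> e \notin cycle_edges c.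
      move=> es; apply/negP => ec; case/negP: vc.
      apply: incident_cycle (ec) _ => //; rewrite lattice_incident //.
      exact: star_lattice es.
    have nI : nx true f i \in I.
      have := off (dual_edge f i); rewrite -(perm_mem (corner_star ef ik)) inE eqxx.
      by move=> /(_ isT); rewrite -interior_across // negbK -!HI fI => /eqP <-.
    have /permP <- := corner_star ef ik.
    rewrite (_ : count _ _ = 3) //.
    by rewrite /= !memE ?even_nx // (nxKn true) fI nI !orbT.
  rewrite star_count0 // (_ : count _ _ = 0) //.
  apply/eqP; rewrite -leqn0 leqNgt -has_count; apply/negP => /hasP[e es /= eE].
  apply: hv; exists e; split; first exact: EH.
  by rewrite lattice_incident //; exact: star_lattice es.
have [kappa hk] := cycle_correction L0 (colored_divergence L0).
pose L' := L ++ [seq (cedge c j, kappa j) | j <- iota 0 (size c)].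
have HL' t : t \in L' -> lattice_edge t.1.
  rewrite mem_cat => /orP[/HL//|/mapP[j]]; rewrite mem_iota => jc ->.
  exact: cedge_lattice.
have DL' v : divergence L' v = 0%R by rewrite divergence_cat hk addrN.
exists (potential L') => f i fI nI; have ef := even_interior fI.
have := potential_coef i HL' DL' ef.
(* Between two interior hexagons the correction is absent, so the potential drops by 3 minus 1
   across matched edges and by -1 across the others. *)
have off : dual_edge f i \notin cycle_edges c.
  by rewrite -interior_across // -!HI fI nI.
rewrite coef_cat (coef_off_cycle Hc kappa off) addr0 coef_cat !coef_const memE // fI /=.
rewrite edge_matchingE //; move: (potential _ _) (potential _ _) => p q.
by case: (_ \in M) => /=; clear; lia.
Qed.

(** * Alternating hexagons as one-hexagon cuts *)

Lemma map_hex_edges M f : even_pt f ->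
  [seq e \in M | e <- hex_edges f] =
  [:: edge_matching M f D0; edge_matching M (nx false f D1) D1;
      edge_matching M f D2; edge_matching M (nx false f D0) D0;
      edge_matching M f D1; edge_matching M (nx false f D2) D2].
Proof.
by move=> ef; rewrite !edge_matchingE ?even_nx // hex_edgesE.
Qed.

Lemma singleton_alternating M f b : perfect_matching c M ->
  cut true I (edge_matching M) (b, [fset f]) ->
  alternating M f /\ b = (dual_edge (nx false f D0) D0 \in M).
Proof.
move=> pM cf; have Hm := pm_matching pM.
have fI : f \in I by case/cutP: cf => _ /fsubsetP h _; apply: h; rewrite inE.
have ef := even_interior fI.
have ev i : even_pt (nx false f i) by rewrite even_nx.
rewrite /alternating map_hex_edges // -(edge_matchingE M D0 (ev D0)).
case: b cf => cf.
  have src := cut_source cf; rewrite !(src _).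
  by rewrite !(negPf (source_out Hm _ fI src)).
have snk := cut_sink cf; rewrite !(snk _).
by rewrite !(negPf (sink_in Hm _ fI snk)).
Qed.

Lemma alternating_cut M f : perfect_matching c M -> f \in I -> alternating M f ->
  cut true I (edge_matching M) (dual_edge (nx false f D0) D0 \in M, [fset f]).
Proof.
move=> pM fI; have ef := even_interior fI.
have ev i : even_pt (nx false f i) by rewrite even_nx.
rewrite /alternating map_hex_edges // -(edge_matchingE M D0 (ev D0)).
case/orP=> /eqP[] a b1 b2 d e g; rewrite d.
  by apply: sink_cut => // -[].
by apply: source_cut => // -[].
Qed.

(** A conflict would be a free arc from one alternating hexagon to another: its tail must be a
    source and its head a sink, and then two matched edges meet at an end of the edge between
    them. *)
Lemma pack_alternating M (s : seq pt) : perfect_matching c M -> uniq s ->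
  (forall f, f \in s -> f \in I /\ alternating M f) ->
  pack true I (edge_matching M)
    [seq (dual_edge (nx false f D0) D0 \in M, [fset f]) | f <- s].
Proof.
move=> pM us hs; have Hm := pm_matching pM.
apply/packP; split=> [W /mapP[f /hs[fI af] ->]|f i nm]; first exact: alternating_cut.
rewrite /load big_map /crosses /hd /=.
have le1 : (\sum_(x <- s) ((f \in [fset x]) != (nx true f i \in [fset x])) <=
    (f \in s) + (nx true f i \in s))%N.
  rewrite -!(count_uniq_mem _ us) -!sum1_count ![X in (_ <= X + _)%N]big_mkcond.
  rewrite [X in (_ <= _ + X)%N]big_mkcond -big_split /=; apply: leq_sum => x _.
  by rewrite !inE ![_ == x]eq_sym; case: (x == f); case: (x == _).
apply: leq_trans le1 _.
case: (boolP (f \in s)) => fs; case: (boolP (_ \in s)) => ns //; exfalso.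
have [fI af] := hs _ fs; have [nI an] := hs _ ns.
have src : forall k, edge_matching M (nx false f k) k.
  have := alternating_cut pM fI af; case: (_ \in M); first exact: cut_source.
  by move/cut_sink/(_ i); rewrite (negPf nm).
have snk : forall k, edge_matching M (nx true f i) k.
  have := alternating_cut pM nI an; case: (_ \in M); last exact: cut_sink.
  by move/cut_source/(_ i); rewrite (nxK true) (negPf nm).
have [k ik] := other_dir i; have := proj2 Hm f i k fI ik.
by rewrite snk src; case: edge_matching.
Qed.

Lemma af_witness M : perfect_matching c M -> exists k, af_is c M k.
Proof.
move=> pM; have Hm := pm_matching pM.
have ex : exists S, anti_forcing c M S.
  exists [fset e in [seq dual_edge e.1 e.2 | e <- free_arcs true I (edge_matching M)]].
  by apply: hitting_anti_forcing => // W cW; exact: cut_crossed Hm cW.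
have [S [hS minS]] := ex_min_nat (fun S : {fset edge} => #|` S|) ex.
by exists #|` S|; split=> //; exists S.
Qed.

Lemma af_pack M k : perfect_matching c M -> af_is c M k ->
  exists2 F, pack true I (edge_matching M) F & size F = k.
Proof.
move=> pM [[S0 [hS0 eS0]] minS]; have Hm := pm_matching pM.
have [F [S [pF SF szS hit]]] := lucchesi_younger
  (fun W => @cut_crossed _ W Hm) (free_arcs true I (edge_matching M)).
have pF' : pack true I (edge_matching M) F.
  by apply: packing_le pF => e ->.
exists F => //; apply/eqP; rewrite eqn_leq -{1}eS0.
rewrite (pack_le_anti_forcing pM pF' hS0) /=.
have := minS _ (hitting_anti_forcing pM SF (fun W cW => hit W cW (fun e eE _ => eE))).
move/leq_trans; apply; apply: leq_trans szS.
rewrite -(size_map (fun e => dual_edge e.1 e.2)).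
by apply: uniq_leq_size; [exact: fset_uniq | move=> e; rewrite inE].
Qed.

(** Every cut crosses a free arc, so none is repeated, and the kind of a one-hexagon cut is
    determined by its hexagon; the packing thus injects into the alternating hexagons. *)
Lemma small_packing_fr M F (s : seq pt) : perfect_matching c M ->
  pack true I (edge_matching M) F -> (forall W, W \in F -> #|` W.2| <= 1) ->
  (forall f, f \in s <-> interior_hex c f /\ alternating M f) ->
  size F <= size s.
Proof.
move=> pM pF small hs; have Hm := pm_matching pM.
have cF W : W \in F -> cut true I (edge_matching M) W by case/packP: pF => + _; exact.
rewrite -(size_map (fun f => (dual_edge (nx false f D0) D0 \in M, [fset f])) s).
have uF : uniq F.
  apply: count_mem_uniq => W; case: (boolP (W \in F)) => WF; last exact/count_memPn.
  have [[f i]] := cut_crossed Hm (cF W WF).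
  rewrite mem_free_arcs => /andP[nm _] cr.
  have := packing_mem_uniq pF nm cr; move: WF; rewrite -has_pred1 has_count.
  by case: (count_mem W F) => [|[]].
apply: uniq_leq_size => // -[b X] WF.
have /cardfs1P[f eX] : #|` X| == 1.
  rewrite eqn_leq (small _ WF) cardfs_gt0.
  by case/cutP: (cF _ WF).
subst X; have := cF _ WF => cW; have [af ->] := singleton_alternating pM cW.
apply/mapP; exists f => //; apply/hs; split=> //; rewrite -HI.
by case/cutP: cW => _ /fsubsetP h _; apply: h; rewrite inE.
Qed.

End System.

Theorem theorem1p7 (c : seq pt) (Hc : lattice_cycle c)
  (Hpm : exists M, perfect_matching c M)
  (A : nat) (HA : Af_is c A)
  (M : {fset edge}) (HM : perfect_matching c M)
  (k : nat) (Hk : af_is c M k) (HkA : k = A \/ k = (A - 1)%N)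
  (n : nat) (Hn : fr_is c M n) :
  k = n.
Proof.
have [I HI] := interior_finite HM; have Hm := pm_matching HI HM.
case: Hn => s [us hs sn]; subst n.
have lower : size s <= k.
  case: Hk => -[S0 [hS0 <-]] _.
  have hs' f : f \in s -> f \in I /\ alternating M f by rewrite HI => /hs.
  have := pack_le_anti_forcing HI HM (pack_alternating HI HM us hs') hS0.
  by rewrite size_map.
apply/eqP; rewrite eqn_leq lower andbT.
have [F0 pF0 szF0] := af_pack HI Hc HM Hk.
have [F [[szF pF] minF]] := @ex_min_nat _
  (fun F => size F = k /\ pack true I (edge_matching M) F) (total_weight I)
  (ex_intro _ F0 (conj szF0 pF0)).
rewrite -szF; apply: (small_packing_fr HI HM pF) => [W WF|]; last exact: hs.
rewrite leqNgt; apply/negP => big.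
have [h Hh] := exists_height HI Hc HM.
have [|m' [F' [Hm' pF' szF']]] := improve Hm Hh pF _ (ex_intro2 _ _ W WF big).
  by move=> G szG pG; apply: minF; rewrite szG.
have [M' [pM' eM']] := matching_pm HI Hm'.
have pF2 : pack true I (edge_matching M') F' by apply: eq_pack pF' => f i; rewrite eM'.
have [k' hk'] := af_witness HI Hc pM'.
(* The new matching forces [k + 2 <= A], impossible in both cases; this stays true where [A - 1] is
   truncated at zero. *)
have := proj2 HA M' k' pM' hk'; case: hk' => -[S' [hS' <-]] _.
have := pack_le_anti_forcing HI pM' pF2 hS'.
by move: szF' HkA; rewrite szF; clear; lia.
Qed.
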